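(* Suppose that the degree sequences $(\boldsymbol d_n)_{n\ge1}$ satisfy Assumption 1(i), Assumption 1(ii), Assumption 2, and $$\nu_n:=\frac{\sum_{i\in[n]}d_i(d_i-1)}{\sum_{i\in[n]}d_i}\longrightarrow\nu>1\quad\text{as } n\to\infty.$$ Let $\lambda\in\mathbb R$ and let $p_c(\lambda)=p_{c,n}(\lambda)=\frac1{\nu_n}+\frac{\lambda}{n^{\eta}}+o(n^{-\eta})$. Let $\mathscr C_{(i)}(p_c(\lambda))$ be the $i$-th largest component of the graph obtained from $\mathrm{CM}_n(\boldsymbol d)$ by percolation with edge retention probability $p_c(\lambda)$, and let $(\mathscr M_i)_{i\ge1}=((M_i,\mathrm d_i,\mu_i))_{i\ge1}$ be the limit in distribution of $(n^{-\eta}\mathscr C_{(i)}(p_c(\lambda)))_{i\ge1}$ in $\mathbb M^{\mathbb N}$ (this limit exists). Let $V_{n,i}$ be a uniformly chosen vertex of $\mathscr C_{(i)}(p_c(\lambda))$, with $(V_{n,i})_{i\ge1}$ independent conditionally on $(\mathscr C_{(i)}(p_c(\lambda)))_{i\ge1}$, and let $V_i$ be chosen from $M_i$ according to $\mu_i$, with $(V_i)_{i\ge1}$ independent conditionally on $(\mathscr M_i)_{i\ge1}$. Then, as $n\to\infty$, $$\big(n^{-\eta}\mathrm{Rad}(V_{n,i},\mathscr C_{(i)}(p_c(\lambda)))\big)_{i\ge1}\xrightarrow{d}\big(\mathrm{Rad}(V_i,\mathscr M_i)\big)_{i\ge1},$$ $$\big(n^{-\eta}\mathrm{diam}(\mathscr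 C_{(i)}(p_c(\lambda)))\big)_{i\ge1}\xrightarrow{d}\big(\mathrm{diam}(\mathscr M_i)\big)_{i\ge1},$$ with respect to the product topology. Moreover, the same result holds for percolation on $\mathrm{UM}_n(\boldsymbol d)$ in place of $\mathrm{CM}_n(\boldsymbol d)$.
   Context: Fix $\tau\in(3,4)$ and set $\alpha=1/(\tau-1)$, $\rho=(\tau-2)/(\tau-1)$, $\eta=(\tau-3)/(\tau-1)$. For each $n$, $\boldsymbol d=\boldsymbol d_n=(d_1,\dots,d_n)$ is a non-increasing sequence of degrees (non-negative integers; dependence on $n$ suppressed) with $\ell_n=\sum_{i\in[n]}d_i$ even. Configuration model $\mathrm{CM}_n(\boldsymbol d)$: the random multigraph on $[n]$ in which vertex $j$ has $d_j$ half-edges and the $\ell_n$ half-edges are paired by a uniformly random perfect matching, each pair forming an edge. $\mathrm{UM}_n(\boldsymbol d)$: a graph chosen uniformly at random from all simple graphs on $[n]$ with degree sequence $\boldsymbol d$. Percolation with edge retention probability $p$: given the graph, each edge is deleted independently with probability $1-p$. Components are ordered by number of vertices, ties broken arbitrarily. For a metric space $(X,\mathrm d)$ and $x\in X$, $\mathrm{Rad}(x,X)=\sup_{y\in X}\mathrm d(x,y)$ and $\mathrm{diam}(X)=\sup_{x,y\in X}\mathrm d(x,y)$. For a component $\mathscr C$ of a graph, $\mathrm{Rad}$ and $\mathrm{diam}$ are taken with respect to the (unscaled) graph distance. $n^{-\eta}\mathscr C$ for a component $\mathscr C$: the vertex set of $\mathscr C$ with metric $n^{-\eta}$ times the graph distance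 and with the probability measure proportional to the counting measure on vertices. $\mathbb M$ is the space of (isometry classes of) compact metric spaces equipped with a measure, endowed with the Gromov--Hausdorff--Prokhorov topology; $\mathbb M^{\mathbb N}$ carries the product topology; $\xrightarrow{d}$ is convergence in distribution. Under the stated hypotheses it is known that $(n^{-\eta}\mathscr C_{(i)}(p_c(\lambda)))_{i\ge1}$ converges in distribution in $\mathbb M^{\mathbb N}$, both for $\mathrm{CM}_n(\boldsymbol d)$ and for $\mathrm{UM}_n(\boldsymbol d)$, to the same limit $(\mathscr M_i)_{i\ge1}$. Notation: $\ell^p_\downarrow=\{(x_i)_{i\ge1}:x_1\ge x_2\ge\cdots,\ \sum_i x_i^p<\infty\}$. Assumption 1. (i) For each fixed $i\ge1$, $n^{-\alpha}d_i\to\theta_i$, where $\boldsymbol\theta=(\theta_1,\theta_2,\dots)\in\ell^3_\downarrow\setminus\ell^2_\downarrow$. (ii) Let $D_n$ be the degree of a uniformly chosen vertex of $[n]$. Then $D_n$ converges in distribution to some discrete random variable $D$, with $\mathbb E[D_n]=\frac1n\sum_i d_i\to\mu:=\mathbb E[D]$, $\mathbb E[D_n^2]=\frac1n\sum_i d_i^2\to\mu_2:=\mathbb E[D^2]$, and $\lim_{K\to\infty}\limsup_{n\to\infty}n^{-3\alpha}\sum_{i=K+1}^n d_i^3=0$. Assumption 2. Let $V_n^*$ be a random vertex with $\mathbb P(V_n^*=i)=d_i/\ell_n$, and let $D_n^*$ be the degree of $V_n^*$. There exist constants $c_0>0$ and $c_1>1$ such that for all $n\ge1$, $\mathbb P(l<D_n^*\le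 c_1 l)\ge c_0/l^{\tau-2}$ for $1\le l<d_1$. *)

(* Defs.v *)
(* Vertices, components and coordinates are numbered from 0: [d n i] and
   [theta i] stand for d_{i+1} and theta_{i+1}. *)
From HB Require Import structures.
From mathcomp Require Import all_boot all_order all_algebra.

Set Implicit Arguments.
Unset Strict Implicit.
Unset Printing Implicit Defensive.

Import Order.TTheory GRing.Theory Num.Theory.

(* A multigraph on [n] is a set of edges, an edge being a 2-element set of
   half-edges; [gm_vtx] sends a half-edge to its vertex.  The random graph of
   the model is uniform on [gm_graphs]. *)
Record graph_model (n : nat) := GraphModel {
  gm_end : finType;
  gm_vtx : gm_end -> 'I_n;
  gm_graphs : {set {set {set gm_end}}} }.

Definition halfedge (n : nat) (d : nat -> nat) : finType :=
  {j : 'I_n & 'I_(d j)}.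

Definition perfect_matchings (T : finType) : {set {set {set T}}} :=
  [set m : {set {set T}} | partition m [set: T] &
                           [forall e in m, #|e : {set T}| == 2]].

Definition simple_graphs (n : nat) (d : nat -> nat) : {set {set {set 'I_n}}} :=
  [set g : {set {set 'I_n}} | [forall e in g, #|e : {set 'I_n}| == 2] &
     [forall i : 'I_n, #|[set e in g | i \in (e : {set 'I_n})]| == d i]].

Definition configuration_model (n : nat) (d : nat -> nat) : graph_model n :=
  GraphModel (fun h : halfedge n d => tag h)
             (perfect_matchings (halfedge n d)).

(* For simple graphs the two ends of an edge are its vertices. *)
Definition uniform_model (n : nat) (d : nat -> nat) : graph_model n :=
  GraphModel (fun i : 'I_n => i) (simple_graphs n d).

Definition adj (n : nat) (G : graph_model n) (S : {set {set gm_end G}}) :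
    rel 'I_n :=
  fun x y => [exists h : gm_end G, exists h' : gm_end G,
    [&& [set h; h'] \in S, gm_vtx h == x & gm_vtx h' == y]].

Lemma adj_sym (n : nat) (G : graph_model n) (S : {set {set gm_end G}}) :
  symmetric (adj S).
Proof.
have sub x y : adj S x y -> adj S y x.
  move=> /existsP[h /existsP[h' /and3P[hS hx hy]]].
  apply/existsP; exists h'; apply/existsP; exists h.
  by rewrite setUC hS hx hy.
by move=> x y; apply/idP/idP; apply: sub.
Qed.

Definition walk (n : nat) (e : rel 'I_n) (x y : 'I_n) (k : nat) : bool :=
  [exists t : k.-tuple 'I_n, path e x t && (last x t == y)].

(* Length of a shortest walk; [n] when [x] and [y] are not connected. *)
Definition gdist (n : nat) (e : rel 'I_n) (x y : 'I_n) : nat :=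
  find (walk e x y) (iota 0 n).

Definition components (n : nat) (e : rel 'I_n) : {set {set 'I_n}} :=
  [set [set y | connect e x y] | x : 'I_n].

(* [C 0, C 1, ...] lists the components by decreasing size, with ties broken
   in an unspecified way, followed by empty sets. *)
Definition ranked_components (n : nat) (e : rel 'I_n)
    (C : nat -> {set 'I_n}) : Prop :=
  exists cs : seq {set 'I_n},
    [/\ perm_eq cs (enum (components e)),
        sorted (fun A B : {set 'I_n} => #|B| <= #|A|) cs
      & forall i, C i = nth set0 cs i].

Definition graph_rad (n : nat) (e : rel 'I_n) (C : {set 'I_n}) (v : 'I_n) :
    nat :=
  \max_(y in C) gdist e v y.

Definition graph_diam (n : nat) (e : rel 'I_n) (C : {set 'I_n}) : nat :=
  \max_(x in C) \max_(y in C) gdist e x y.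

(* [None] is the value of the random vertex of a component that does not
   exist. *)
Definition ograph_rad (n : nat) (e : rel 'I_n) (C : {set 'I_n})
    (v : option 'I_n) : nat :=
  if v is Some x then graph_rad e C x else 0.

Section GraphDistance.
Variables (n : nat) (e : rel 'I_n).

Lemma walkP x y k :
  reflect (exists s, [/\ size s = k, path e x s & last x s = y])
          (walk e x y k).
Proof.
apply: (iffP existsP) => [[t /andP[pt /eqP lt]]|[s [sk ps ls]]].
  by exists t; rewrite size_tuple.
have sk' : size s == k by apply/eqP.
by exists (Tuple sk') => /=; rewrite ps ls eqxx.
Qed.

Lemma gdist_le x y : gdist e x y <= n.
Proof. by rewrite -[leqRHS](size_iota 0) find_size. Qed.

Lemma gdist_le_walk x y k : walk e x y k -> gdist e x y <= k.
Proof.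
move=> wk; have [kn|nk] := ltnP k n; last exact: leq_trans (gdist_le _ _) nk.
rewrite leqNgt; apply/negP => /(before_find 0).
by rewrite nth_iota// add0n wk.
Qed.

Lemma gdist_walk x y : gdist e x y < n -> walk e x y (gdist e x y).
Proof.
move=> lt; have h : has (walk e x y) (iota 0 n) by rewrite has_find size_iota.
by have := nth_find 0 h; rewrite nth_iota// add0n.
Qed.

Lemma gdistxx x : gdist e x x = 0.
Proof.
by apply/eqP; rewrite -leqn0; apply/gdist_le_walk/walkP; exists [::].
Qed.

Lemma gdist0_eq x y : gdist e x y = 0 -> x = y.
Proof.
move=> d0; have := @gdist_walk x y; rewrite d0 (leq_ltn_trans _ (ltn_ord x))//.
by move=> /(_ isT)/walkP[[|a s] []] //= _ _ <-.
Qed.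

Lemma gdist_triangle y x z : gdist e x z <= gdist e x y + gdist e y z.
Proof.
have [xyn|nxy] := ltnP (gdist e x y) n; last first.
  exact: leq_trans (gdist_le _ _) (leq_trans nxy (leq_addr _ _)).
have [yzn|nyz] := ltnP (gdist e y z) n; last first.
  exact: leq_trans (gdist_le _ _) (leq_trans nyz (leq_addl _ _)).
have /walkP[s [ss ps ls]] := gdist_walk xyn.
have /walkP[t [st pt lt]] := gdist_walk yzn.
apply/gdist_le_walk/walkP; exists (s ++ t).
by rewrite size_cat ss st cat_path ps ls pt last_cat ls lt.
Qed.

Hypothesis esym : symmetric e.

Lemma walk_sym x y k : walk e x y k = walk e y x k.
Proof.
have sub u v : walk e u v k -> walk e v u k.
  move=> /walkP[s [ss ps ls]]; apply/walkP; exists (rev (belast u s)).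
  split; first by rewrite size_rev size_belast.
    rewrite -ls rev_path; apply: sub_path ps => a b.
    by rewrite esym.
  by case: s {ss ps} ls => [|a s] /= ls; rewrite ?rev_cons ?last_rcons.
by apply/idP/idP; apply: sub.
Qed.

Lemma gdist_sym x y : gdist e x y = gdist e y x.
Proof. by apply: eq_find => k; rewrite walk_sym. Qed.

End GraphDistance.

Local Open Scope ring_scope.

(* Probability that percolation on the edge set [E] retains exactly [S]. *)
Definition percolation_weight (R : numDomainType) (T : finType) (p : R)
    (E S : {set {set T}}) : R :=
  if S \subset E then p ^+ #|S| * (1 - p) ^+ #|E :\: S| else 0.

Definition uniform_vertex (R : numFieldType) (n : nat) (C : {set 'I_n})
    (v : option 'I_n) : R :=
  if v is Some x then (x \in C)%:R / #|C|%:R else (C == set0)%:R.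

From mathcomp Require Import all_classical all_reals all_analysis.
Import numFieldNormedType.Exports.
Local Open Scope classical_set_scope.
Local Open Scope ring_scope.

(* Compact metric spaces with a finite Borel measure.  The point carried by a
   [pmetricType] is only a witness of non-emptiness, required by the library's
   measurable types; no notion below depends on it. *)
#[short(type="pmetricType")]
HB.structure Definition PointedMetric (R : realType) :=
  {T of Pointed T & Metric R T}.

Definition borel (T : ptopologicalType) := g_sigma_algebraType (@open T).

Record mmspace (R : realType) := MMSpace {
  mm_car :> pmetricType R;
  mm_compact : compact [set: mm_car];
  mm_mu : {finite_measure set (borel mm_car) -> \bar R} }.

Record marked_mmspace (R : realType) := Marked {
  mk_space : mmspace R;
  mk_point : mk_space }.
Arguments Marked {R} mk_space mk_point.

Definition mm_rad (R : realType) (X : mmspace R) (x : X) : R :=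
  sup (range (fun y : X => mdist x y)).

Definition mm_diam (R : realType) (X : mmspace R) : R :=
  sup (range (fun z : X * X => mdist z.1 z.2)).

Section GHP.
Variable R : realType.
Implicit Types X Y : mmspace R.

Definition correspondence X Y (C : set (borel X * borel Y)) : Prop :=
  [/\ measurable C, forall x, exists y, C (x, y) & forall y, exists x, C (x, y)].

Definition distortion X Y (C : set (borel X * borel Y)) : R :=
  sup [set r | exists (x x' : X) (y y' : Y),
    [/\ C (x, y), C (x', y') & r = `|mdist x x' - mdist y y'|]].

(* Total variation norm of the signed measure [m1 - m2]: by the Hahn
   decomposition the supremum is the sum of its positive and negative parts. *)
Definition tv_dist (d : measure_display) (T : measurableType d)
    (m1 m2 : set T -> \bar R) : R :=
  sup [set `|fine (m1 A) - fine (m2 A)| + `|fine (m1 (~` A)) - fine (m2 (~` A))|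
      | A in measurable].

Definition discrepancy X Y
    (pi : {finite_measure set (borel X * borel Y)%type -> \bar R}) : R :=
  tv_dist (mm_mu X) (fun A => pi (A `*` setT)) +
  tv_dist (mm_mu Y) (fun B => pi (setT `*` B)).

(* Infimum over measurable correspondences [C] containing [F] and finite Borel
   measures [pi] on the product of max(dis C / 2, D(pi), pi(complement of C)). *)
Definition ghp_rel X Y (F : set (X * Y)) : R :=
  inf [set r | exists (C : set (borel X * borel Y))
      (pi : {finite_measure set (borel X * borel Y)%type -> \bar R}),
    [/\ correspondence C, F `<=` C &
        r = Num.max (distortion C / 2)
                    (Num.max (discrepancy pi) (fine (pi (~` C))))]].

Definition ghp X Y : R := @ghp_rel X Y set0.

Definition marked_ghp (X Y : marked_mmspace R) : R :=
  ghp_rel [set (mk_point X, mk_point Y)].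

End GHP.

(* The topology of a distance function.  On [mmspace] and [marked_mmspace] the
   distance of isometric spaces is 0, so open sets, Borel sets and continuous
   functions are those of the spaces of isometry classes. *)
Section DistanceTopology.
Variables (R : realType) (T : Type) (dist : T -> T -> R).

Definition dist_open : set_system T :=
  [set U | forall x, U x ->
     exists2 e : R, 0 < e & forall y, dist x y < e -> U y].

Lemma dist_openT : dist_open setT.
Proof. by move=> x _; exists 1. Qed.

Lemma dist_openI : setI_closed dist_open.
Proof.
move=> A B oA oB x [/oA[a a0 hA] /oB[b b0 hB]].
exists (Num.min a b); first by rewrite lt_min a0 b0.
by move=> y; rewrite lt_min => /andP[/hA ? /hB ?].
Qed.

Lemma dist_open_bigU (I : Type) (f : I -> set T) :
  (forall i, dist_open (f i)) -> dist_open (\bigcup_i f i).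
Proof.
move=> of_ x [i _ /of_[e e0 he]]; exists e => // y /he fy.
by exists i.
Qed.

End DistanceTopology.

HB.instance Definition _ (R : realType) := gen_eqMixin (mmspace R).
HB.instance Definition _ (R : realType) := gen_choiceMixin (mmspace R).
HB.instance Definition _ (R : realType) :=
  @isOpenTopological.Build (mmspace R) (dist_open (@ghp R))
    (@dist_openT _ _ _) (@dist_openI _ _ _) (@dist_open_bigU _ _ _).

HB.instance Definition _ (R : realType) := gen_eqMixin (marked_mmspace R).
HB.instance Definition _ (R : realType) := gen_choiceMixin (marked_mmspace R).
HB.instance Definition _ (R : realType) :=
  @isOpenTopological.Build (marked_mmspace R) (dist_open (@marked_ghp R))
    (@dist_openT _ _ _) (@dist_openI _ _ _) (@dist_open_bigU _ _ _).

Definition mmseq (R : realType) : topologicalType :=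
  {ptws nat -> mmspace R}.

Definition realseq (R : realType) : topologicalType := {ptws nat -> R}.

(* Components as metric measure spaces: [c] times the graph distance, and the
   normalized counting measure.  Vertices are represented by their values in
   [nat], since the carrier of an [mmspace] has to live in a universe smaller
   than that of ['I_n]. *)
Lemma comp_label (n : nat) (C : {set 'I_n}) (x : 'I_n) :
  x \in C -> nat_of_ord x \in [seq nat_of_ord x | x in C].
Proof. by move=> xC; apply: map_f; rewrite mem_enum. Qed.

Definition comp_space (R : realType) (c : {posnum R}) (n : nat) (e : rel 'I_n)
    (esym : symmetric e) (C : {set 'I_n}) (x0 : 'I_n) (Cx0 : x0 \in C) : Set :=
  {k : nat | k \in [seq nat_of_ord x | x in C]}.

Section ComponentSpace.
Variables (R : realType) (c : {posnum R}) (n : nat) (e : rel 'I_n).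
Variables (esym : symmetric e) (C : {set 'I_n}) (x0 : 'I_n) (Cx0 : x0 \in C).

Local Notation T := (comp_space c esym Cx0).

HB.instance Definition _ := Choice.on T.
HB.instance Definition _ := isPointed.Build T
  (exist _ (nat_of_ord x0) (comp_label Cx0)).

Definition comp_vertex (u : T) : 'I_n := iinv (valP u).

Lemma comp_vertexE u : comp_vertex u = val u :> nat.
Proof. exact: f_iinv. Qed.

Lemma comp_vertex_in u : comp_vertex u \in C.
Proof. exact: mem_iinv. Qed.


Let cdist (x y : T) : R := c%:num *
  (gdist e (comp_vertex x) (comp_vertex y))%:R.

Let cdistxx x : cdist x x = 0.
Proof. by rewrite /cdist gdistxx mulr0. Qed.

Let cdist_positivity x y : cdist x y = 0 -> x = y.
Proof.
move/eqP; rewrite mulf_eq0 gt_eqF//= pnatr_eq0 => /eqP/gdist0_eq xy.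
by apply: val_inj; rewrite -!comp_vertexE xy.
Qed.

Let cdist_sym x y : cdist x y = cdist y x.
Proof. by rewrite /cdist gdist_sym. Qed.

Let cdist_triangle y x z : cdist x z <= cdist x y + cdist y z.
Proof. by rewrite /cdist -mulrDr ler_pM2l// -natrD ler_nat gdist_triangle. Qed.

HB.instance Definition _ := isMetric.Build R T
  cdistxx cdist_positivity cdist_sym cdist_triangle.

End ComponentSpace.

Section ComponentMMSpace.
Variables (R : realType) (c : {posnum R}).

Lemma comp_space_compact (n : nat) (e : rel 'I_n) (esym : symmetric e)
    (C : {set 'I_n}) (x0 : 'I_n) (Cx0 : x0 \in C) :
  compact [set: comp_space c esym Cx0].
Proof.
apply: finite_compact.
apply: (sub_finite_set (B := range (fun x : {x : 'I_n | x \in C} =>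
    exist (fun k => k \in [seq nat_of_ord x | x in C]) (nat_of_ord (val x))
      (comp_label (valP x)) : comp_space c esym Cx0))); last first.
  exact/finite_image/finite_finset.
move=> u _; exists (exist _ (comp_vertex u) (comp_vertex_in u)) => //.
by apply: val_inj; rewrite /= comp_vertexE.
Qed.

Definition nonempty_comp_mm (n : nat) (e : rel 'I_n) (esym : symmetric e)
    (C : {set 'I_n}) (x0 : 'I_n) (Cx0 : x0 \in C) : mmspace R :=
  @MMSpace R (comp_space c esym Cx0) (@comp_space_compact n e esym C x0 Cx0)
    (mnormalize counting (dirac point) : probability _ R).

(* When the component does not exist: a one-point space of mass 1. *)
Definition point_mm : mmspace R :=
  @nonempty_comp_mm 1 (fun _ _ => false) (fun _ _ => erefl)
    [set: 'I_1]%SET ord0 (finset.in_setT ord0).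

Definition comp_mm (n : nat) (e : rel 'I_n) (esym : symmetric e)
    (C : {set 'I_n}) : mmspace R :=
  match set_0Vmem C with
  | inl _ => point_mm
  | inr (exist x0 Cx0) => nonempty_comp_mm esym Cx0
  end.

End ComponentMMSpace.

(* A random graph of the model [G], percolation on it with retention
   probability [p], its ranked components, and a random vertex of each.
   [pc_graph_law] is void when the model has no graph at all (a degree sequence
   that is not graphical). *)
Record percolation (R : realType) (n : nat) (G : graph_model n) (p : R) :=
  Percolation {
  pc_disp : measure_display;
  pc_Om : measurableType pc_disp;
  pc_P : probability pc_Om R;
  pc_graph : pc_Om -> {set {set gm_end G}};
  pc_kept : pc_Om -> {set {set gm_end G}};
  pc_comp : pc_Om -> nat -> {set 'I_n};
  pc_vtx : pc_Om -> nat -> option 'I_n;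
  pc_graph_law : gm_graphs G != finset.set0 ->
    forall E S : {set {set gm_end G}},
      let A := [set w | pc_graph w = E /\ pc_kept w = S] in
      measurable A /\
      pc_P A = ((E \in gm_graphs G)%:R / #|gm_graphs G|%:R *
                percolation_weight p E S)%:E;
  pc_comp_ranked : forall w, ranked_components (adj (pc_kept w)) (pc_comp w);
  pc_vtx_comp : forall w i,
    if pc_vtx w i is Some x then x \in pc_comp w i
    else pc_comp w i == finset.set0;
  (* Given the percolated graph and its ranked components, the vertices are
     independent and uniform. *)
  pc_vtx_law : forall (S : {set {set gm_end G}}) (C : nat -> {set 'I_n})
      (k : nat) (v : nat -> option 'I_n),
    let A := [set w | pc_kept w = S /\ pc_comp w = C] in
    let B := [set w | forall i, (i < k)%N -> pc_vtx w i = v i] in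
    [/\ measurable A, measurable (A `&` B) &
        pc_P (A `&` B) = (pc_P A * (\prod_(i < k) uniform_vertex R (C i) (v i))%:E)%E]
  }.

(* n^{-eta}, made positive at n = 0 as well, where it is irrelevant. *)
Definition graph_scale (R : realType) (eta : R) (n : nat) : {posnum R} :=
  PosNum (powR_gt0 (- eta) (ltr0Sn R n.-1)).

Section PercolationFunctionals.
Variables (R : realType) (eta : R) (n : nat) (G : graph_model n) (p : R).
Variable X : percolation G p.

Definition scaled_comps (w : pc_Om X) : mmseq R :=
  fun i => comp_mm (graph_scale eta n) (adj_sym (pc_kept w)) (pc_comp w i).

Definition scaled_rads (w : pc_Om X) : realseq R :=
  fun i => n%:R `^ (- eta) *
    (ograph_rad (adj (pc_kept w)) (pc_comp w i) (pc_vtx w i))%:R.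

Definition scaled_diams (w : pc_Om X) : realseq R :=
  fun i => n%:R `^ (- eta) * (graph_diam (adj (pc_kept w)) (pc_comp w i))%:R.

End PercolationFunctionals.

Definition is_bounded (R : realType) (S : Type) (f : S -> R) : Prop :=
  exists B : R, forall x, `|f x| <= B.

Definition random_element (d : measure_display) (Om : measurableType d)
    (S : topologicalType) (X : Om -> S) : Prop :=
  forall U : set S, open U -> measurable (X @^-1` U).

Definition borel_fun (R : realType) (S : topologicalType) (f : S -> R) : Prop :=
  forall B : set R, measurable B -> <<s @open S >> (f @^-1` B).

Definition cvg_in_distribution (R : realType) (S : topologicalType)
    (dn : nat -> measure_display) (On : forall n, measurableType (dn n))
    (Pn : forall n, probability (On n) R) (Xn : forall n, On n -> S)
    (d : measure_display) (Om : measurableType d) (P : probability Om R)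
    (X : Om -> S) : Prop :=
  forall f : S -> R, continuous f -> is_bounded f ->
    (\int[Pn n]_w f (Xn n w)) @[n --> \oo] --> \int[P]_w f (X w).

(* [V w i] is a point of [M w i]; conditionally on [M] the [V _ i] are
   independent and [V _ i] is distributed as the measure of [M _ i]. *)
Definition sampled_points (R : realType) (d : measure_display)
    (Om : measurableType d) (P : probability Om R)
    (M : Om -> mmseq R) (V : forall (w : Om) (i : nat), (M w i : mmspace R)) :
    Prop :=
  (forall i, random_element (fun w => Marked (M w i) (V w i))) /\
  forall (g : mmseq R -> R) (k : nat) (phi : nat -> marked_mmspace R -> R),
    borel_fun g -> is_bounded g ->
    (forall i, borel_fun (phi i)) -> (forall i, is_bounded (phi i)) ->
    \int[P]_w (g (M w) * \prod_(i < k) phi i (Marked (M w i) (V w i))) =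
    \int[P]_w (g (M w) *
      \prod_(i < k) \int[mm_mu (M w i)]_x phi i (Marked (M w i) x)).

Section Assumptions.
Variables (R : realType) (tau : R) (d : nat -> nat -> nat).

Definition alpha : R := 1 / (tau - 1).
Definition eta : R := (tau - 3) / (tau - 1).

Definition degree_sequences : Prop :=
  forall n, (forall i j, (i <= j < n)%N -> (d n j <= d n i)%N) /\
            ~~ odd (\sum_(i < n) d n i).

Definition lp_down (p : nat) (x : nat -> R) : Prop :=
  (forall i j, (i <= j)%N -> x j <= x i) /\ cvgn (series (fun i => x i ^+ p)).

Definition assumption1i (theta : nat -> R) : Prop :=
  (forall i, n%:R `^ (- alpha) * (d n i)%:R @[n --> \oo] --> theta i) /\
  lp_down 3 theta /\ ~ lp_down 2 theta.

Definition vertex_mean (f : R -> R) (n : nat) : R :=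
  n%:R^-1 * \sum_(i < n) f (d n i)%:R.

Definition assumption1ii : Prop :=
  (exists (dO : measure_display) (Om : measurableType dO)
          (P : probability Om R) (D : {dRV P >-> R}) (mu mu2 : R),
    [/\ forall f : R -> R, continuous f -> is_bounded f ->
          vertex_mean f n @[n --> \oo] --> \int[P]_w f (D w),
        ('E_P[D])%E = mu%:E,
        vertex_mean id n @[n --> \oo] --> mu,
        ('E_P[fun w => (D w ^+ 2)%R])%E = mu2%:E &
        vertex_mean (fun x => x ^+ 2) n @[n --> \oo] --> mu2]) /\
  limn_esup (fun n =>
    (n%:R `^ (- (3 * alpha)) * \sum_(K <= i < n) (d n i)%:R ^+ 3)%:E)
    @[K --> \oo] --> (0%E : \bar R).

Definition total_degree (n : nat) : R := \sum_(i < n) (d n i)%:R.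

Definition assumption2 : Prop :=
  exists c0 c1 : R, [/\ 0 < c0, 1 < c1 &
    forall n l : nat, (1 <= n)%N -> (1 <= l < d n 0)%N ->
      c0 / l%:R `^ (tau - 2) <=
      \sum_(i < n | (l < d n i)%N && ((d n i)%:R <= c1 * l%:R))
         (d n i)%:R / total_degree n].

Definition nu_n (n : nat) : R :=
  (\sum_(i < n) (d n i)%:R * ((d n i)%:R - 1)) / total_degree n.

End Assumptions.

(* Main.v *)
(* The diameter, the total mass and, for a bounded Lipschitz [phi], the radial
   mean, i.e. the integral of [phi (Rad (x, X))] over [x] with respect to the
   measure of [X], are continuous functionals of a compact metric measure space
   for the Gromov-Hausdorff-Prokhorov distance.  This settles the diameters by
   composition.  For the radii, conditional independence of the sampled vertices
   turns the expectation of a product of [phi_i (Rad (V_i, X_i))] into that of the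
   product of the radial means, on the discrete side as well as in the limit, so
   these expectations converge; and expectations of products of bounded Lipschitz
   functions of finitely many coordinates determine convergence in distribution
   of random real sequences. *)
Require Import Defs.
From mathcomp Require Import all_boot all_order all_algebra.
From mathcomp Require Import all_classical all_reals all_analysis.
From mathcomp Require Import measurable_realfun lra.
Import Order.TTheory GRing.Theory Num.Theory.
Import numFieldNormedType.Exports.
Local Open Scope classical_set_scope.
Local Open Scope ring_scope.

Set Implicit Arguments.
Unset Strict Implicit.
Unset Printing Implicit Defensive.

(** * Gromov-Hausdorff-Prokhorov couplings *)

(** A coupling of two spaces only compares masses of matched sets, so integrals of radial functions
    have to be compared through their superlevel sets. Radial means are the right functionals
    because closeness of unmarked spaces does not pair individual sampled points; it only controls
    the law of what is seen from them. The reduction to products of one-coordinate functions meets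
    an obstacle: a bounded continuous function on a countable product of lines need not be uniformly
    continuous. It is therefore approximated pointwise and from below by finite combinations of
    products of tents. This yields only a lower bound on the integrals for large [n]; applying it to
    [B + f] and to [B - f], where [B] bounds the absolute value of [f], gives the limit. The total
    mass enters because radial means are bounded by it. It equals 1 on every component and is a
    continuous functional, so it equals 1 almost surely in the limit. *)

Section MMSpaces.
Variable R : realType.
Implicit Types (X Y : mmspace R) (e : R).

Lemma mdist_lipschitz_continuous (T : pmetricType R) (L : R) (f : T -> R) :
  0 <= L -> (forall x y, `|f x - f y| <= L * mdist x y) -> continuous f.
Proof.
move=> L0 flip x; apply/cvgrPdist_lt => e e0.
(* [L] may be 0, so the radius comes from dividing by [L + 1]. *)
have L1 : 0 < L + 1 by lra.
near=> y; apply: le_lt_trans (flip _ _) _.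
apply: (@le_lt_trans _ _ ((L + 1) * mdist x y)).
  by rewrite ler_wpM2r ?mdist_ge0// lerDl.
rewrite -ltr_pdivlMl// mulrC.
have : ball x (e / (L + 1)) y by near: y; apply: nbhsx_ballx; rewrite divr_gt0.
by rewrite ballEmdist.
Unshelve. all: by end_near. Qed.

(** Compactness enters here: the distance to [point] is continuous, hence bounded, and any two
    points are joined through [point]. Without such a bound the [sup] in radius and diameter would
    be a default value. *)
Lemma mdist_bounded X : exists B : R, forall x y : X, mdist x y <= B.
Proof.
pose f (x : X) : R^o := mdist (point : X) x.
have cf : continuous f.
  apply: (mdist_lipschitz_continuous ler01) => x y; rewrite /f mul1r ler_norml.
  have := metric_triangle (point : X) x y.
  have := metric_triangle (point : X) y x.
  by rewrite (metric_sym y x) => ? ?; apply/andP; split; lra.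
have := continuous_compact (continuous_subspaceT cf) (@mm_compact _ X).
move=> /compact_bounded[M [_ /(_ (M + 1))]]; rewrite ltrDl ltr01 => /(_ isT) fB.
exists ((M + 1) + (M + 1)) => x y.
rewrite (le_trans (metric_triangle x point y))// lerD//.
  by rewrite metric_sym (le_trans (ler_norm _))//; apply: fB; exists x.
by rewrite (le_trans (ler_norm _))//; apply: fB; exists y.
Qed.

Lemma mdist_le_rad X (x y : X) : mdist x y <= mm_rad x.
Proof.
have [B dB] := mdist_bounded X; apply: ub_le_sup; last by exists y.
by exists B => _ [z _ <-].
Qed.

Lemma rad_le X (x : X) (r : R) : (forall y, mdist x y <= r) -> mm_rad x <= r.
Proof.
move=> xr; apply: ge_sup; first by exists (mdist x point); exists point.
by move=> _ [y _ <-].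
Qed.

Lemma mdist_le_diam X (x y : X) : mdist x y <= mm_diam X.
Proof.
have [B dB] := mdist_bounded X; apply: ub_le_sup; last by exists (x, y).
by exists B => _ [z _ <-].
Qed.

Lemma diam_le X (r : R) : (forall x y : X, mdist x y <= r) -> mm_diam X <= r.
Proof.
move=> xr; apply: ge_sup.
  by exists (mdist (point : X) point); exists (point, point).
by move=> _ [[x y] _ <-].
Qed.

Lemma rad_lipschitz X (x y : X) : `|mm_rad x - mm_rad y| <= mdist x y.
Proof.
have half (u v : X) : mm_rad u <= mm_rad v + mdist u v.
  apply: rad_le => z; rewrite addrC (le_trans (metric_triangle u v z))//.
  by rewrite lerD2l mdist_le_rad.
have := half x y; have := half y x; rewrite (metric_sym y x) ler_norml.
by move=> ? ?; apply/andP; split; lra.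
Qed.

(** The bound [B] makes the set under the [sup] of [tv_dist] bounded, so that the supremum dominates
    each of its members. *)
Lemma tv_dist_ge (d : measure_display) (T : measurableType d)
    (m1 m2 : set T -> \bar R) (B : R) (A : set T) :
  (forall A, measurable A -> `|fine (m1 A)| <= B) ->
  (forall A, measurable A -> `|fine (m2 A)| <= B) ->
  measurable A -> `|fine (m1 A) - fine (m2 A)| <= tv_dist m1 m2.
Proof.
move=> B1 B2 mA.
apply: (@le_trans _ _ (`|fine (m1 A) - fine (m2 A)| +
  `|fine (m1 (~` A)) - fine (m2 (~` A))|)); first by rewrite lerDl.
apply: ub_le_sup; last by exists A.
exists (B + B + (B + B)) => _ [C mC <-].
have mC' := measurableC mC.
by apply: lerD; (apply: le_trans (ler_normB _ _) _; apply: lerD; auto).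
Qed.

Lemma fine_finite_measure_le (d : measure_display) (T : measurableType d)
    (m : {finite_measure set T -> \bar R}) (A B : set T) :
  measurable A -> measurable B -> A `<=` B -> fine (m A) <= fine (m B).
Proof.
move=> mA mB AB; apply: fine_le; rewrite ?fin_num_measure//.
by apply: le_measure => //; rewrite inE.
Qed.

(* All that is used of a correspondence [C] and a measure on the product nearly
   carried by [C]: the masses of two sets matched by [C] are compared through the
   measure of the product. *)
Definition ghp_coupling X Y (e : R) (C : X -> Y -> Prop) :=
  [/\ (forall x, exists y, C x y) /\ (forall y, exists x, C x y),
      forall x x' y y', C x y -> C x' y' ->
        `|mdist x x' - mdist y y'| <= e,
      forall (A : set (borel X)) (B : set (borel Y)),
        measurable A -> measurable B -> (forall x y, C x y -> A x -> B y) ->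
        fine (mm_mu X A) <= fine (mm_mu Y B) + e &
      forall (A : set (borel X)) (B : set (borel Y)),
        measurable A -> measurable B -> (forall x y, C x y -> B y -> A x) ->
        fine (mm_mu Y B) <= fine (mm_mu X A) + e].

(** The factor 2 has two sources: it is half of the distortion that lies below [e], and the mass
    comparison adds a discrepancy below [e] to a mass below [e] outside [C]. The set [F] is carried
    along to keep marked points matched. *)
Lemma ghp_rel_lt X Y (F : set (X * Y)) e : ghp_rel F < e ->
  exists2 C : X -> Y -> Prop, ghp_coupling (2 * e) C &
    forall x y, F (x, y) -> C x y.
Proof.
rewrite /ghp_rel => /inf_lt[].
  (* The infimum is over a nonempty set: the full product with a Dirac mass is admissible. *)
  pose pi : {finite_measure set (borel X * borel Y)%type -> \bar R} :=
    @dirac _ (borel X * borel Y)%type (point, point) R.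
  eexists; exists setT, pi; split => //; split => //.
  - by move=> x; exists point.
  - by move=> y; exists point.
move=> _ [C [pi [[mC CX CY] FC ->]]].
rewrite gt_max gt_max => /and3P[dis disc piC].
exists (fun x y => C (x, y)) => //; last by move=> x y /FC.
have [BX dX] := mdist_bounded X; have [BY dY] := mdist_bounded Y.
have bnd (d : measure_display) (T : measurableType d)
    (m : {finite_measure set T -> \bar R}) (A : set T) : measurable A ->
    `|fine (m A)| <= fine (m setT).
  by move=> mA; rewrite ger0_norm ?fine_ge0// fine_finite_measure_le.
pose pX A := pi (A `*` setT : set (borel X * borel Y)).
pose pY B := pi (setT `*` B : set (borel X * borel Y)).
have mX A : measurable A -> measurable (A `*` setT : set (borel X * borel Y)).
  by move=> mA; exact: measurableX.
have mY B : measurable B -> measurable (setT `*` B : set (borel X * borel Y)).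
  by move=> mB; exact: measurableX.
have discX A : measurable A ->
    `|fine (mm_mu X A) - fine (pX A)| <= tv_dist (mm_mu X) pX.
  move=> mA; apply: (@tv_dist_ge _ _ _ _
      (Num.max (fine (mm_mu X setT)) (fine (pi setT)))) => // D mD.
    by rewrite le_max bnd.
  by rewrite le_max (bnd _ _ pi) ?orbT//; exact: mX.
have discY B : measurable B ->
    `|fine (mm_mu Y B) - fine (pY B)| <= tv_dist (mm_mu Y) pY.
  move=> mB; apply: (@tv_dist_ge _ _ _ _
      (Num.max (fine (mm_mu Y setT)) (fine (pi setT)))) => // D mD.
    by rewrite le_max bnd.
  by rewrite le_max (bnd _ _ pi) ?orbT//; exact: mY.
have tX : tv_dist (mm_mu X) pX + tv_dist (mm_mu Y) pY < e by [].
(* When [C] matches [A] into [B], the strip over [A] lies in the strip over [B], up to the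
   complement of [C]. *)
have piU (S1 S2 : set (borel X * borel Y)) : measurable S1 -> measurable S2 ->
    S1 `<=` S2 `|` ~` C -> fine (pi S1) <= fine (pi S2) + fine (pi (~` C)).
  move=> m1 m2 S12; have mC' := measurableC mC.
  apply: (@le_trans _ _ (fine (pi (S2 `|` ~` C)))).
    by apply: fine_finite_measure_le => //; exact: measurableU.
  rewrite -fineD ?fin_num_measure//; apply: fine_le.
  - by apply: fin_num_measure; exact: measurableU.
  - by rewrite fin_numD !fin_num_measure.
  - exact: measureU2.
split => //.
- move=> x x' y y' Cxy Cxy'.
  apply: (@le_trans _ _ (distortion C)); last by lra.
  apply: ub_le_sup; last by exists x, x', y, y'.
  exists (BX + BY) => _ [z [z' [t [t' [_ _ ->]]]]].
  by apply: le_trans (ler_normB _ _) _; rewrite !ger0_norm ?mdist_ge0// lerD.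
- move=> A B mA mB AB.
  have := discX _ mA; have := discY _ mB; rewrite !ler_norml.
  move=> /andP[? ?] /andP[? ?].
  have : fine (pX A) <= fine (pY B) + fine (pi (~` C)).
    apply: piU; [exact: mX|exact: mY|].
    move=> [x y] [/= Ax _]; have [Cxy|] := pselect (C (x, y)); last by right.
    by left; split => //=; exact: AB Cxy Ax.
  by lra.
- move=> A B mA mB AB.
  have := discX _ mA; have := discY _ mB; rewrite !ler_norml.
  move=> /andP[? ?] /andP[? ?].
  have : fine (pY B) <= fine (pX A) + fine (pi (~` C)).
    apply: piU; [exact: mY|exact: mX|].
    move=> [x y] [/= _ By]; have [Cxy|] := pselect (C (x, y)); last by right.
    by left; split => //=; exact: AB Cxy By.
  by lra.
Qed.

End MMSpaces.

(** * Comparison of integrals through superlevel sets *)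

Section LayerCake.
Variable R : realType.

(** The sum counts the naturals below [y], so for nonnegative [y] it is the ceiling of [y]. The
    induction runs on the minimum of [y] and [N], since the bound on [y] is not inherited by smaller
    [N]. *)
Lemma step_sum_ge (N : nat) (y : R) : y <= N%:R ->
  y <= \sum_(j < N) (j%:R < y)%R%:R.
Proof.
move=> yN; suff : Num.min y N%:R <= \sum_(j < N) (j%:R < y)%R%:R :> R.
  by rewrite min_l.
elim: N {yN} => [|N IH]; first by rewrite big_ord0 ge_min lexx orbT.
rewrite big_ord_recr/= -natr1; have [Ny|yN] := ltP N%:R y.
  by rewrite min_r ?(ltW Ny)// in IH; rewrite ge_min lerD2r IH orbT.
by rewrite min_l// in IH; rewrite ge_min addr0 IH.
Qed.

Lemma step_sum_le (N : nat) (y : R) : 0 <= y ->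
  \sum_(j < N) (j%:R < y)%R%:R <= y + 1.
Proof.
move=> y0; elim: N => [|N IH]; first by rewrite big_ord0; lra.
rewrite big_ord_recr/=; have [Ny|yN] := ltP N%:R y; last by rewrite addr0.
rewrite lerD// (le_trans _ (ltW Ny))//.
apply: (@le_trans _ _ (\sum_(j < N) 1)).
  by apply: ler_sum => j _; case: (_ < _).
by rewrite sumr_const card_ord.
Qed.

Lemma integral_step (d : measure_display) (T : measurableType d)
    (m : {finite_measure set T -> \bar R}) (N : nat) (h : R)
    (A : nat -> set T) : 0 <= h -> (forall j, measurable (A j)) ->
  (\int[m]_x (\sum_(j < N) h * \1_(A j) x)%:E)%E =
  (\sum_(j < N) h * fine (m (A j)))%:E.
Proof.
move=> h0 mA; under eq_integral do rewrite -sumEFin.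
rewrite ge0_integral_sum//; last 2 first.
- by move=> j; apply/measurable_EFinP; apply: measurable_funM.
- by move=> j x _; rewrite lee_fin mulr_ge0.
rewrite -sumEFin; apply: eq_bigr => j _.
under eq_integral do rewrite EFinM.
rewrite ge0_integralZl//; last by apply/measurable_EFinP.
by rewrite integral_indic// setIT EFinM fineK// fin_num_measure.
Qed.

Lemma integral_bounded_fin (d : measure_display) (T : measurableType d)
    (m : {finite_measure set T -> \bar R}) (f : T -> R) (B : R) :
  measurable_fun setT f -> (forall x, 0 <= f x <= B) ->
  (\int[m]_x (f x)%:E)%E \is a fin_num.
Proof.
move=> mf f01; rewrite ge0_fin_numE; last first.
  by apply: integral_ge0 => x _; rewrite lee_fin; case/andP: (f01 x).
apply: (@le_lt_trans _ _ (\int[m]_x (cst B%:E x))%E).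
  apply: ge0_le_integral => //.
  - by move=> x _; rewrite lee_fin; case/andP: (f01 x).
  - exact/measurable_EFinP.
  - by move=> x _; rewrite lee_fin; case/andP: (f01 x).
rewrite integral_cst// -[X in (_ * X)%E](@fineK _ (m setT)) ?fin_num_measure//.
by rewrite -EFinM ltry.
Qed.

(* Up to an error [1 / n.+1], each integral is the average over [j <= n] of the
   measures of the superlevel sets at [j / n.+1]. *)
Lemma Rintegral_superlevel_le (d1 d2 : measure_display)
    (T1 : measurableType d1) (T2 : measurableType d2)
    (m1 : {finite_measure set T1 -> \bar R})
    (m2 : {finite_measure set T2 -> \bar R})
    (f1 : T1 -> R) (f2 : T2 -> R) (delta kappa : R) :
  0 <= delta ->
  measurable_fun setT f1 -> measurable_fun setT f2 ->
  (forall x, 0 <= f1 x <= 1) -> (forall x, 0 <= f2 x <= 1) ->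
  (forall s, fine (m1 [set x | s < f1 x]) <=
             fine (m2 [set x | s - delta < f2 x]) + kappa) ->
  \int[m1]_x f1 x <= \int[m2]_x f2 x + delta * fine (m2 setT) + kappa.
Proof.
move=> delta0 mf1 mf2 f1_01 f2_01 lev.
have mlev (d : measure_display) (T : measurableType d) (f : T -> R) (s : R) :
    measurable_fun setT f -> measurable [set x | s < f x].
  move=> mf; rewrite [X in measurable X](_ : _ = setT `&` f @^-1` `]s, +oo[).
    exact: mf.
  by apply/seteqP; split => x /=; rewrite in_itv/= andbT// => -[].
have memlev (T : Type) (f : T -> R) (s : R) x :
    (x \in [set x | s < f x]) = (s < f x).
  by apply/idP/idP => [/set_mem//|?]; exact/mem_set.
have step (n : nat) : \int[m1]_x f1 x <= \int[m2]_x f2 x +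
    (delta + n.+1%:R^-1) * fine (m2 setT) + kappa.
  pose h : R := n.+1%:R^-1; have h0 : 0 < h by rewrite invr_gt0.
  have Nh : n.+1%:R * h = 1 by rewrite mulfV.
  pose A1 j := [set x | j%:R * h < f1 x].
  pose A2 j := [set x | j%:R * h - delta < f2 x].
  have mA1 j : measurable (A1 j) by exact: mlev.
  have mA2 j : measurable (A2 j) by exact: mlev.
  have indE (j : nat) (y : R) : (j%:R * h < y) = (j%:R < y * n.+1%:R).
    by rewrite -ltr_pdivlMr// /h invrK.
  have le1 : \int[m1]_x f1 x <= \sum_(j < n.+1) h * fine (m1 (A1 j)).
    rewrite -lee_fin fineK; last exact: integral_bounded_fin f1_01.
    rewrite -integral_step ?(ltW h0)//.
    apply: ge0_le_integral => //.
    - by move=> x _; rewrite lee_fin; case/andP: (f1_01 x).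
    - exact/measurable_EFinP.
    - apply/measurable_EFinP; apply: measurable_sum => j.
      exact: measurable_funM.
    move=> x _; rewrite lee_fin -mulr_sumr -ler_pdivrMl// /h invrK mulrC.
    have -> : \sum_(j < n.+1) \1_(A1 j) x =
        \sum_(j < n.+1) (j%:R < f1 x * n.+1%:R)%R%:R :> R.
      by apply: eq_bigr => j _; rewrite indicE -indE memlev.
    apply: step_sum_ge; rewrite ler_piMl//; by case/andP: (f1_01 x).
  (* Here the step function is at most [f2 + delta + h] pointwise: counting naturals overshoots by
     at most one step [h]. *)
  have le2 : \sum_(j < n.+1) h * fine (m2 (A2 j)) <=
      \int[m2]_x f2 x + (delta + h) * fine (m2 setT).
    rewrite -lee_fin -integral_step ?(ltW h0)//.
    rewrite EFinD fineK; last exact: integral_bounded_fin f2_01.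
    rewrite EFinM fineK ?fin_num_measure// -integral_cst//.
    rewrite -ge0_integralD//; last 3 first.
    - by move=> x _; rewrite lee_fin; case/andP: (f2_01 x).
    - exact/measurable_EFinP.
    - by move=> x _; rewrite lee_fin; lra.
    apply: ge0_le_integral => //.
    - move=> x _; rewrite lee_fin; apply: sumr_ge0 => j _.
      by rewrite mulr_ge0// ltW.
    - apply/measurable_EFinP; apply: measurable_sum => j.
      exact: measurable_funM.
    - by apply: emeasurable_funD => //; exact/measurable_EFinP.
    move=> x _; rewrite lee_fin -mulr_sumr -ler_pdivlMl// /h invrK mulrC.
    have -> : \sum_(j < n.+1) \1_(A2 j) x =
        \sum_(j < n.+1) (j%:R < (f2 x + delta) * n.+1%:R)%R%:R :> R.
      apply: eq_bigr => j _; by rewrite indicE -indE -ltrBlDr memlev.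
    rewrite [leRHS](_ : _ = (f2 x + delta) * n.+1%:R + 1); last first.
      by rewrite addrA mulrDl mulVf.
    apply: step_sum_le; rewrite mulr_ge0// addr_ge0//.
    by case/andP: (f2_01 x).
  apply: le_trans le1 _.
  apply: (@le_trans _ _ (\sum_(j < n.+1) (h * fine (m2 (A2 j)) + h * kappa))).
    by apply: ler_sum => j _; rewrite -mulrDr ler_pM2l//; exact: lev.
  rewrite big_split/= sumr_const card_ord -[_ *+ _]mulr_natl mulrA Nh mul1r.
  by rewrite lerD2r.
apply/ler_addgt0Pr => e e0.
pose c := fine (m2 setT).
have c0 : 0 <= c by rewrite fine_ge0.
(* Only the term [c / n.+1] depends on [n]; this choice brings it below [e]. *)
pose n := Num.truncn (c / e).
have ce : c * n.+1%:R^-1 <= e.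
  rewrite ler_pdivrMr// -ler_pdivrMl// mulrC.
  by rewrite ltW// real_truncnS_gt// num_real.
apply: le_trans (step n) _; rewrite -/c.
rewrite [leRHS]addrAC lerD2r -addrA lerD2l mulrDl lerD2l.
by rewrite mulrC.
Qed.

End LayerCake.

(** * Continuous functionals of metric measure spaces *)

Section BorelFunctions.
Variable R : realType.

Lemma sigma_algebra_preimage_sub (T : Type) (U : Type) (f : T -> U)
    (G : set (set T)) (H : set (set U)) :
  (forall A, H A -> <<s G >> (f @^-1` A)) ->
  forall A, <<s H >> A -> <<s G >> (f @^-1` A).
Proof.
move=> HG A.
have sa := @sigma_algebra_image _ _ setT f _ (smallest_sigma_algebra setT G).
suff : <<s H >> `<=` image_set_system setT f <<s G >>.
  by move=> /(_ A) /[apply]; rewrite /image_set_system/= setTI.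
by apply: smallest_sub => // B /HG; rewrite /image_set_system/= setTI.
Qed.

Lemma continuous_borel_fun (S : topologicalType) (f : S -> R) :
  continuous f -> borel_fun f.
Proof.
move=> /continuousP cf B mB.
have := @sigma_algebra_preimage_sub _ _ f open (@RGenOpens.G R).
apply; last first.
  have : (@ocitv R).-sigma.-measurable B by exact: mB.
  by rewrite RGenOpens.measurableE.
move=> _ [a [b ->]]; apply: sub_sigma_algebra; apply: cf.
exact: interval_open.
Qed.

Lemma continuous_measurable_borel (T : ptopologicalType) (f : T -> R) :
  continuous f -> measurable_fun (setT : set (borel T)) f.
Proof. by move=> cf _ B mB; rewrite setTI; exact: continuous_borel_fun. Qed.

Lemma random_element_measurable (d : measure_display) (Om : measurableType d)
    (S : topologicalType) (X : Om -> S) (f : S -> R) :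
  random_element X -> continuous f -> measurable_fun setT (f \o X).
Proof.
move=> rX cf _ B mB; rewrite setTI comp_preimage.
have := @sigma_algebra_preimage_sub _ _ X (@measurable _ Om) (@open S).
rewrite (sigma_algebra_id (@sigma_algebra_measurable _ Om)).
apply; first exact: rX.
exact: continuous_borel_fun.
Qed.

End BorelFunctions.

Section GHPContinuity.
Variable R : realType.
Implicit Types (X Y : mmspace R).

(** A set is open when each of its points has its own radius, so a preimage is checked point by
    point with the radius supplied at that point. *)
Lemma ghp_continuous (h : mmspace R -> R) :
  (forall X (e : R), 0 < e ->
    exists2 r, 0 < r & forall Y, ghp X Y < r -> `|h X - h Y| < e) ->
  continuous h.
Proof.
move=> hc; apply/continuousP => U oU.
change (dist_open (@ghp R) (h @^-1` U)) => X UX.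
move: oU; rewrite openE => /(_ _ UX)/nbhs_ballP[e /= e0 eU].
have [r r0 rh] := hc X e e0.
by exists r => // Y /rh XY; exact: eU.
Qed.

Lemma marked_ghp_continuous (h : marked_mmspace R -> R) :
  (forall Z (e : R), 0 < e ->
    exists2 r, 0 < r & forall Z', marked_ghp Z Z' < r -> `|h Z - h Z'| < e) ->
  continuous h.
Proof.
move=> hc; apply/continuousP => U oU.
change (dist_open (@marked_ghp R) (h @^-1` U)) => X UX.
move: oU; rewrite openE => /(_ _ UX)/nbhs_ballP[e /= e0 eU].
have [r r0 rh] := hc X e e0.
by exists r => // Y /rh XY; exact: eU.
Qed.

Lemma ghp_coupling_rad X Y (e : R) (C : X -> Y -> Prop) x y :
  ghp_coupling e C -> C x y -> `|mm_rad x - mm_rad y| <= e.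
Proof.
move=> [[CX CY] Cd _ _] Cxy.
have h1 : mm_rad x <= mm_rad y + e.
  apply: rad_le => x'; have [y' Cxy'] := CX x'.
  have := Cd _ _ _ _ Cxy Cxy'; rewrite ler_norml => /andP[_ ?].
  by have := mdist_le_rad y y'; lra.
have h2 : mm_rad y <= mm_rad x + e.
  apply: rad_le => y'; have [x' Cxy'] := CY y'.
  have := Cd _ _ _ _ Cxy Cxy'; rewrite ler_norml => /andP[? _].
  by have := mdist_le_rad x x'; lra.
by rewrite ler_norml; apply/andP; split; lra.
Qed.

Lemma ghp_coupling_diam X Y (e : R) (C : X -> Y -> Prop) :
  ghp_coupling e C -> `|mm_diam X - mm_diam Y| <= e.
Proof.
move=> [[CX CY] Cd _ _].
have h1 : mm_diam X <= mm_diam Y + e.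
  apply: diam_le => x x'; have [[y Cxy] [y' Cxy']] := (CX x, CX x').
  have := Cd _ _ _ _ Cxy Cxy'; rewrite ler_norml => /andP[_ ?].
  by have := mdist_le_diam y y'; lra.
have h2 : mm_diam Y <= mm_diam X + e.
  apply: diam_le => y y'; have [[x Cxy] [x' Cxy']] := (CY y, CY y').
  have := Cd _ _ _ _ Cxy Cxy'; rewrite ler_norml => /andP[? _].
  by have := mdist_le_diam x x'; lra.
by rewrite ler_norml; apply/andP; split; lra.
Qed.

Definition mm_mass X : R := fine (mm_mu X setT).

Lemma ghp_coupling_mass X Y (e : R) (C : X -> Y -> Prop) :
  ghp_coupling e C -> `|mm_mass X - mm_mass Y| <= e.
Proof.
move=> [_ _ XY YX]; have := XY setT setT; have := YX setT setT.
rewrite -/(mm_mass X) -/(mm_mass Y) => /(_ measurableT measurableT).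
move=> /(_ (fun _ _ _ _ => I)) ? /(_ measurableT measurableT).
by move=> /(_ (fun _ _ _ _ => I)) ?; rewrite ler_norml; apply/andP; split; lra.
Qed.

Lemma diam_continuous : continuous (@mm_diam R).
Proof.
(* A distance below [e / 4] gives a coupling of error [e / 2], strictly below [e]. *)
apply: ghp_continuous => X e e0; exists (e / 4); first by lra.
move=> Y /ghp_rel_lt[C /ghp_coupling_diam XY _].
by apply: le_lt_trans XY _; lra.
Qed.

Lemma mass_continuous : continuous mm_mass.
Proof.
apply: ghp_continuous => X e e0; exists (e / 4); first by lra.
move=> Y /ghp_rel_lt[C /ghp_coupling_mass XY _].
by apply: le_lt_trans XY _; lra.
Qed.

Definition marked_rad (Z : marked_mmspace R) : R := mm_rad (mk_point Z).

Lemma marked_rad_continuous : continuous marked_rad.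
Proof.
apply: marked_ghp_continuous => Z e e0; exists (e / 4); first by lra.
move=> Z' /ghp_rel_lt[C XY FC].
apply: le_lt_trans (ghp_coupling_rad XY (FC _ _ erefl)) _; lra.
Qed.

Section RadialMean.
Variables (L : R) (phi : R -> R).
Hypothesis L0 : 0 <= L.
Hypothesis phi01 : forall r, 0 <= phi r <= 1.
Hypothesis phiL : forall r s, `|phi r - phi s| <= L * `|r - s|.

Definition radial_mean X : R := \int[mm_mu X]_x phi (mm_rad x).

Lemma radial_measurable X :
  measurable_fun (setT : set (borel X)) (fun x : X => phi (mm_rad x)).
Proof.
apply: continuous_measurable_borel.
apply: (mdist_lipschitz_continuous L0) => x y.
by apply: le_trans (phiL _ _) _; rewrite ler_wpM2l// rad_lipschitz.
Qed.

Lemma marked_radial_continuous :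
  continuous (fun Z : marked_mmspace R => phi (marked_rad Z)).
Proof.
apply: marked_ghp_continuous => Z e e0; exists (e / (4 * (L + 1))).
  by rewrite divr_gt0// mulr_gt0// ltr_wpDl.
move=> Z' /ghp_rel_lt[C XY FC].
apply: le_lt_trans (phiL _ _) _.
have L1 : 0 < L + 1 by rewrite ltr_wpDl.
have := ghp_coupling_rad XY (FC _ _ erefl).
rewrite -/(marked_rad Z) -/(marked_rad Z') => dr.
apply: (@le_lt_trans _ _ ((L + 1) * (2 * (e / (4 * (L + 1)))))).
  by apply: ler_pM => //; rewrite lerDl.
by rewrite mulrCA (mulrC (L + 1)) invfM -!mulrA mulVf ?gt_eqF//; lra.
Qed.

Lemma radial_mean_ge0 X : 0 <= radial_mean X.
Proof. by apply: Rintegral_ge0 => x _; case/andP: (phi01 (mm_rad x)). Qed.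

(** Matched points have radii within [e], hence values of [phi] within [L * e]. So [C] sends each
    superlevel set into the one lowered by [L * e], with mass error [e], and the superlevel
    comparison applies. The term [mm_mass X + e] bounds the masses of both spaces. *)
Lemma ghp_coupling_radial_mean X Y (e : R) (C : X -> Y -> Prop) :
  0 <= e -> ghp_coupling e C ->
  `|radial_mean X - radial_mean Y| <= L * e * (mm_mass X + e) + e.
Proof.
move=> e0 CXY; have mXY := ghp_coupling_mass CXY.
have radC x y (Cxy : C x y) := ghp_coupling_rad CXY Cxy.
have dphi x y : C x y -> `|phi (mm_rad x) - phi (mm_rad y)| <= L * e.
  by move=> /radC Cxy; apply: le_trans (phiL _ _) _; rewrite ler_wpM2l.
have mlev (Z : mmspace R) (s : R) :
    measurable ([set z : Z | s < phi (mm_rad z)] : set (borel Z)).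
  rewrite [X in measurable X](_ : _ = setT `&`
      (fun z : Z => phi (mm_rad z)) @^-1` `]s, +oo[).
    by apply: (radial_measurable (X := Z)) => //; exact: measurable_itv.
  by apply/seteqP; split => x /=; rewrite in_itv/= andbT// => -[].
have [_ _ levXY levYX] := CXY.
have Le : 0 <= L * e by rewrite mulr_ge0.
have h1 : radial_mean X <= radial_mean Y + L * e * mm_mass Y + e.
  apply: Rintegral_superlevel_le => //; try exact: radial_measurable.
  move=> s; apply: levXY => // x y /dphi; rewrite ler_norml/= => /andP[_ ?] ?.
  by lra.
have h2 : radial_mean Y <= radial_mean X + L * e * mm_mass X + e.
  apply: Rintegral_superlevel_le => //; try exact: radial_measurable.
  move=> s; apply: levYX => // x y /dphi; rewrite ler_norml/= => /andP[? _] ?.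
  by lra.
have mX : L * e * mm_mass X <= L * e * (mm_mass X + e).
  by rewrite ler_wpM2l// lerDl.
have mY : L * e * mm_mass Y <= L * e * (mm_mass X + e).
  rewrite ler_wpM2l//; move: mXY; rewrite ler_norml => /andP[? _]; lra.
by rewrite ler_norml; apply/andP; split; lra.
Qed.

Lemma radial_mean_continuous : continuous radial_mean.
Proof.
apply: ghp_continuous => X e e0.
have m0 : 0 <= mm_mass X by rewrite fine_ge0.
(* For an error [r] at most 1 the bound of the coupling is at most [r * K], and [r] at most
   [e / (2 * K)] makes it at most [e / 2]. *)
pose K := L * (mm_mass X + 1) + 1.
have K0 : 0 < K by rewrite ltr_wpDl// mulr_ge0// addr_ge0.
pose r := Num.min 1 (e / (2 * K)).
have r0 : 0 < r by rewrite lt_min ltr01 divr_gt0// mulr_gt0.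
exists (r / 2); first by lra.
move=> Y /ghp_rel_lt[C]; rewrite mulrC divfK// => CXY _.
apply: le_lt_trans (ghp_coupling_radial_mean (ltW r0) CXY) _.
apply: (@le_lt_trans _ _ (r * K)).
  rewrite /K [leRHS]mulrDr mulr1 lerD2r mulrA (mulrC r L).
  by rewrite ler_wpM2l ?mulr_ge0 ?(ltW r0)// lerD2l ge_min lexx.
apply: (@le_lt_trans _ _ (e / (2 * K) * K)).
  by rewrite ler_pM2r// ge_min lexx orbT.
by rewrite invfM -!mulrA mulVf ?gt_eqF//; lra.
Qed.

End RadialMean.
End GHPContinuity.

(** * Convergence in distribution of random sequences *)

Section BoundedIntegrals.
Variables (R : realType) (d : measure_display) (Om : measurableType d).
Variable P : probability Om R.
Implicit Types f g : Om -> R.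

Lemma bounded_integrable f (B : R) : measurable_fun setT f ->
  (forall w, `|f w| <= B) -> P.-integrable setT (EFin \o f).
Proof.
move=> mf fB; apply: measurable_bounded_integrable => //.
  by rewrite (le_lt_trans (probability_le1 _ _))// ltry.
exists B; split; first exact: num_real.
by move=> C BC w _ /=; apply: le_trans (fB w) (ltW BC).
Qed.

Lemma Rintegral_sum (I : Type) (r : seq I) (F : I -> Om -> R) :
  (forall i, measurable_fun setT (F i)) ->
  (forall i, is_bounded (F i)) ->
  \int[P]_w (\sum_(i <- r) F i w) = \sum_(i <- r) \int[P]_w F i w.
Proof.
move=> mF bF; have iF i : P.-integrable setT (EFin \o F i).
  by have [B FB] := bF i; exact: bounded_integrable FB.
elim: r => [|i r IH].
  rewrite big_nil -[RHS](_ : \int[P]_w 0 = 0 :> R); last first.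
    by rewrite Rintegral_cst// mul0r.
  by apply: eq_Rintegral => w _; rewrite big_nil.
rewrite big_cons -IH -RintegralD//; last first.
  rewrite (_ : EFin \o _ = (fun w => \sum_(j <- r) (F j w)%:E)%E).
    by apply: integrable_sum => // j _; exact: iF.
  by apply/funext => w /=; rewrite sumEFin.
by apply: eq_Rintegral => w _; rewrite big_cons.
Qed.

End BoundedIntegrals.

(** * A partition of unity of the line by tents *)

Section Tents.
Variable R : realType.
Implicit Types (x y t : R) (N j : nat).

Definition clip t : R := Num.min 1 (Num.max 0 t).

Lemma clip01 t : 0 <= clip t <= 1.
Proof. by rewrite /clip le_min ler01 le_max lexx/= ge_min lexx. Qed.

Lemma clip_gt0 t : 0 < clip t -> 0 < t.
Proof. by rewrite /clip lt_min ltr01 lt_max ltxx. Qed.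

Lemma clip_lt1 t : clip t < 1 -> t < 1.
Proof. by rewrite /clip gt_min ltxx/= gt_max ltr01. Qed.

Lemma clip_lip t x : `|clip t - clip x| <= `|t - x|.
Proof.
have half u v : clip u - clip v <= `|u - v|.
  have h1 : u - v <= `|u - v| by exact: ler_norm.
  have h0 := normr_ge0 (u - v).
  by rewrite /clip; case: (leP 0 u) => ?; case: (leP 0 v) => ?;
    rewrite ?(min_r ler01); [case: (leP 1 u) => ?; case: (leP 1 v) => ?
      |case: (leP 1 u) => ?|case: (leP 1 v) => ?|]; lra.
by rewrite ler_norml half lerNl opprB distrC half.
Qed.

(* The first and the last ramp are constant, so the first and the last tent
   have unbounded supports and the tents add up to 1 on the whole line. *)
Definition ramp N j x : R :=
  if j == 0 then 1 else if (2 * N ^ 2 < j)%N then 0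
  else clip (N%:R * x + N%:R ^+ 2 - j%:R).

(** In the variable [u = N * x + N ^ 2], which maps [-N, N] onto [0, 2N^2], a tent with
    [0 < j < 2 * N ^ 2] is the hat function on [j, j + 2] with peak at [j + 1]. *)
Definition tent N j x : R := ramp N j x - ramp N j.+1 x.

Lemma ramp01 N j x : 0 <= ramp N j x <= 1.
Proof.
rewrite /ramp; case: ifP => _; first by rewrite ler01 lexx.
by case: ifP => _; [rewrite lexx ler01|exact: clip01].
Qed.

Lemma tent01 N j x : 0 <= tent N j x <= 1.
Proof.
have /andP[? ?] := ramp01 N j x; have /andP[? ?] := ramp01 N j.+1 x.
suff : 0 <= tent N j x by move=> -> /=; rewrite /tent; lra.
rewrite /tent subr_ge0 /ramp /=; case: eqP => [_|_].
  case: ifP => // _.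
  by case/andP: (clip01 (N%:R * x + N%:R ^+ 2 - j.+1%:R)).
have clip0 t := proj1 (andP (clip01 t)).
case: ltnP => jN; first by case: ifP => _; [exact: lexx|exact: clip0].
rewrite ltnNge (ltnW jN)/=.
rewrite /clip le_min ge_min lexx/= ge_min; apply/orP; right.
by rewrite ge_max le_max lexx/= le_max -natr1; apply/orP; right; lra.
Qed.

Lemma ramp_lip N j x y : `|ramp N j x - ramp N j y| <= N%:R * `|x - y|.
Proof.
rewrite /ramp; case: ifP => _; first by rewrite subrr normr0 mulr_ge0.
case: ifP => _; first by rewrite subrr normr0 mulr_ge0.
apply: le_trans (clip_lip _ _) _.
rewrite [leRHS](_ : _ = `|N%:R * (x - y)|); last by rewrite normrM ger0_norm.
by rewrite le_eqVlt; apply/orP; left; apply/eqP; congr `|_|; lra.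
Qed.

Lemma tent_lip N j x y : `|tent N j x - tent N j y| <= (2 * N%:R) * `|x - y|.
Proof.
have := ramp_lip N j x y; have := ramp_lip N j.+1 x y; rewrite /tent !ler_norml.
by move=> /andP[? ?] /andP[? ?]; apply/andP; split; lra.
Qed.

Lemma sum_tent N x : \sum_(j < (2 * N ^ 2).+1) tent N j x = 1.
Proof.
rewrite -(big_mkord xpredT (fun j => tent N j x)).
rewrite (telescope_sumr_eq (fun j => - ramp N j x))//.
  by rewrite /ramp/= ltnSn; lra.
by move=> j _; rewrite /tent; lra.
Qed.

(** The two outer tents have unbounded supports; [1 < N] and the bound on [x] exclude them. On the
    others [N * x + N ^ 2] stays in an open interval of length 2, whence the width [2 / N]; sharing
    a tent with [x] then confines [y]. *)
Lemma tent_support N j x y : (1 < N)%N -> `|x| <= N.-1%:R ->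
  0 < tent N j x -> 0 < tent N j y -> `|x - y| < 2 / N%:R.
Proof.
case: N => // N; rewrite ltnS lt0n -(eqr_nat R) => N1 xN.
have N0 : 0 < N%:R :> R by rewrite lt_neqAle eq_sym N1 ler0n.
have N2 : 1 <= N%:R :> R by rewrite ler1n lt0n -(eqr_nat R).
rewrite ltr_pdivlMr// /tent /ramp -[j.+1 == 0%N]/false -natr1.
move: xN; rewrite ler_norml => /andP[xN1 xN2].
have [->|j0] := eqVneq j 0%N.
  have -> : (2 * N.+1 ^ 2 < 1)%N = false.
    by rewrite ltnS leqn0 muln_eq0 expn_eq0.
  rewrite subr_gt0 => /clip_lt1; rewrite -natr1; nra.
have [Nj|jN] := ltnP (2 * N.+1 ^ 2) j.
  by rewrite (ltn_trans Nj (ltnSn j)) subrr ltxx.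
have [Nj|jN'] := ltnP (2 * N.+1 ^ 2) j.+1.
  have {Nj jN} <- : (2 * N.+1 ^ 2 = j)%N.
    by apply/eqP; rewrite eqn_leq jN -ltnS Nj.
  rewrite subr0 => /clip_gt0; rewrite natrM natrX -natr1; nra.
have supp t : 0 < clip ((N%:R + 1) * t + (N%:R + 1) ^+ 2 - j%:R) -
    clip ((N%:R + 1) * t + (N%:R + 1) ^+ 2 - j.+1%:R) ->
    0 < (N%:R + 1) * t + (N%:R + 1) ^+ 2 - j%:R < 2.
  rewrite subr_gt0 => tt; apply/andP; split.
    apply: clip_gt0; apply: le_lt_trans tt.
    by case/andP: (clip01 ((N%:R + 1) * t + (N%:R + 1) ^+ 2 - j.+1%:R)).
  have : (N%:R + 1) * t + (N%:R + 1) ^+ 2 - j.+1%:R < 1.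
    apply: clip_lt1; apply: lt_le_trans tt _.
    by case/andP: (clip01 ((N%:R + 1) * t + (N%:R + 1) ^+ 2 - j%:R)).
  by rewrite -natr1; lra.
move=> /supp/andP[x1 x2] /supp/andP[y1 y2].
have NN : 0 <= N%:R + 1 :> R by lra.
have -> : `|x - y| * (N%:R + 1) = `|(x - y) * (N%:R + 1)|.
  by rewrite normrM (ger0_norm NN).
rewrite ltr_norml; apply/andP; split; lra.
Qed.

End Tents.

(** * Approximation from below of continuous functions of sequences *)

Section TentApproximation.
Variables (R : realType) (f : realseq R -> R).
Implicit Types (x y : realseq R).
Hypothesis cf : continuous f.
Hypothesis f0 : forall x, 0 <= f x.

(** The single parameter [N] sets the number of coordinates, the mesh [1 / N] and the range [-N, N],
    so all three improve together. *)
Definition tent_index (N : nat) := {ffun 'I_N -> 'I_(2 * N ^ 2).+1}.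

Definition cell N (j : tent_index N) x : R := \prod_(i < N) tent N (j i) (x i).

Definition cell_inf N (j : tent_index N) : R := inf (f @` [set y | 0 < cell j y]).

(* A finite combination of products of tents that stays below [f] and tends to
   [f] pointwise: each cell carries the infimum of [f] over it. *)
Definition tent_approx N x : R := \sum_(j : tent_index N) cell_inf j * cell j x.

Lemma cell_ge0 N (j : tent_index N) x : 0 <= cell j x.
Proof. by apply: prodr_ge0 => i _; case/andP: (tent01 N (j i) (x i)). Qed.

Lemma sum_cell N x : \sum_(j : tent_index N) cell j x = 1.
Proof.
rewrite /cell -(bigA_distr_bigA (fun (i : 'I_N) (j : 'I_(2 * N ^ 2).+1) =>
  tent N j (x i))).
by apply: big1 => i _; exact: sum_tent.
Qed.

Lemma cell_inf_lb N (j : tent_index N) :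
  has_lbound (f @` [set y | 0 < cell j y]).
Proof. by exists 0 => _ [y _ <-]. Qed.

Lemma cell_inf_le N (j : tent_index N) x : 0 < cell j x -> cell_inf j <= f x.
Proof. by move=> jx; apply: ge_inf; [exact: cell_inf_lb|exists x]. Qed.

Lemma tent_approx_le N x : tent_approx N x <= f x.
Proof.
rewrite -[leRHS]mulr1 -(sum_cell N x) mulr_sumr; apply: ler_sum => j _.
have := cell_ge0 j x; rewrite le_eqVlt => /predU1P[<-|jx].
  by rewrite !mulr0.
by rewrite ler_pM2r// cell_inf_le.
Qed.

Lemma cell_inf_ge0 N (j : tent_index N) : 0 <= cell_inf j.
Proof.
(* The infimum of an empty set is 0 by convention. *)
rewrite /cell_inf; have [->|/set0P fj] := eqVneq (f @` [set y | 0 < cell j y]) set0.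
  by rewrite inf0.
by apply: lb_le_inf => // _ [y _ <-].
Qed.

Lemma tent_approx_ge0 N x : 0 <= tent_approx N x.
Proof. by apply: sumr_ge0 => j _; rewrite mulr_ge0 ?cell_inf_ge0 ?cell_ge0. Qed.

Lemma cell_gt0 N (j : tent_index N) x i :
  0 < cell j x -> 0 < tent N (j i) (x i).
Proof.
rewrite /cell (bigD1 i)//= => jx.
have /andP[t0 _] := tent01 N (j i) (x i).
rewrite lt_neqAle t0 andbT eq_sym; apply/eqP => t00.
by rewrite t00 mul0r ltxx in jx.
Qed.

(** The approximation at [x] is an average of cell infima, so some cell of positive weight at [x]
    has an infimum not above it; otherwise a vanishing sum would have positive terms. The point [y]
    nearly attains that infimum, and lies in the same cell as [x]. *)
Lemma tent_approx_near N x : exists y, f y <= tent_approx N x + N.+1%:R^-1 /\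
  forall i : 'I_N, exists j, 0 < tent N j (x i) /\ 0 < tent N j (y i).
Proof.
have [j [jx jf]] : exists j : tent_index N, 0 < cell j x /\
    cell_inf j <= tent_approx N x.
  apply: contrapT => nj.
  have {}nj (j : tent_index N) : 0 < cell j x -> tent_approx N x < cell_inf j.
    by move=> jx; rewrite ltNge; apply/negP => jf; apply: nj; exists j.
  have s0 : \sum_(j : tent_index N) (cell_inf j - tent_approx N x) * cell j x = 0.
    under eq_bigr do rewrite mulrBl.
    by rewrite sumrB -mulr_sumr sum_cell mulr1 subrr.
  have all0 (j : tent_index N) : cell j x = 0.
    have := cell_ge0 j x; rewrite le_eqVlt => /predU1P[//|jx].
    have := @psumr_eq0P _ _ xpredT _ _ s0 j isT.
    have ge0 (i : tent_index N) : 0 <= (cell_inf i - tent_approx N x) * cell i x.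
      have := cell_ge0 i x; rewrite le_eqVlt => /predU1P[<-|ix].
        by rewrite mulr0.
      by apply: mulr_ge0; [rewrite subr_ge0 ltW// nj|exact: ltW].
    move=> /(_ (fun i _ => ge0 i))/eqP; rewrite mulf_eq0 => /orP[|/eqP//].
    by rewrite subr_eq0 gt_eqF// nj.
  have := sum_cell N x; under eq_bigr do rewrite all0.
  by rewrite sumr_const mul0rn => /eqP; rewrite eq_sym oner_eq0.
have hinf : has_inf (f @` [set y | 0 < cell j y]).
  by split; [exists (f x); exists x|exact: cell_inf_lb].
have N0 : 0 < N.+1%:R^-1 :> R by rewrite invr_gt0.
have [_ [y jy <-] fy] := inf_adherent N0 hinf.
exists y; split; first by apply: le_trans (ltW fy) _; rewrite lerD2r.
by move=> i; exists (j i); split; apply: cell_gt0.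
Qed.

(** The nearby points [y N] share tents with [x], hence converge to it in each coordinate, which is
    convergence in the product topology. Continuity at [x] alone then squeezes the approximation
    between [f (y N) - 1 / N.+1] and [f x]. *)
Lemma cvg_tent_approx x : tent_approx N x @[N --> \oo] --> f x.
Proof.
pose y N := projT1 (cid (tent_approx_near N x)).
have yP N := projT2 (cid (tent_approx_near N x)).
have yx : y @ \oo --> x.
  apply/pointwise_cvgP => i.
  suff : y N i @[N --> \oo] --> x i by [].
  apply/cvgrPdist_lt => e e0.
  near=> N.
  have iN : (i < N)%N by near: N; exact: nbhs_infty_gt.
  have [j [tx ty]] := (yP N).2 (Ordinal iN).
  apply: lt_trans (tent_support _ _ tx ty) _.
  - by near: N; exact: nbhs_infty_gt.
  - apply: (@le_trans _ _ (Num.truncn `|x i|).+1%:R).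
      by rewrite ltW// real_truncnS_gt// num_real.
    rewrite ler_nat ltn_predRL; near: N; exact: nbhs_infty_gt.
  - rewrite ltr_pdivrMr; last by rewrite ltr0n (leq_ltn_trans _ iN).
    rewrite -ltr_pdivrMl// mulrC.
    apply: (@lt_le_trans _ _ (Num.truncn (2 / e)).+1%:R).
      by rewrite real_truncnS_gt// num_real.
    rewrite ler_nat; near: N; exact: nbhs_infty_gt.
have fy : f (y N) @[N --> \oo] --> f x by apply: continuous_cvg => //; exact: cf.
apply: (@squeeze_cvgr _ _ _ _ (fun N => f (y N) - N.+1%:R^-1) (fun=> f x)).
- near=> N; rewrite tent_approx_le andbT lerBlDr.
  exact: (yP N).1.
- rewrite -[X in _ --> X]subr0; apply: cvgB => //.
  exact: cvg_harmonic.
- exact: cvg_cst.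
Unshelve. all: by end_near. Qed.

End TentApproximation.

Section ProductFunctionals.
Variable R : realType.

Lemma lipschitz_continuous (L : R) (f : R -> R) :
  0 <= L -> (forall x y, `|f x - f y| <= L * `|x - y|) -> continuous f.
Proof.
move=> L0 flip x; apply/cvgrPdist_lt => e e0.
have L1 : 0 < L + 1 by rewrite ltr_wpDl.
have eL : 0 < e / (L + 1) by rewrite divr_gt0.
apply: filterS (nbhsx_ballx x _ eL) => y xy.
apply: le_lt_trans (flip _ _) _.
apply: (@le_lt_trans _ _ ((L + 1) * `|x - y|)).
  by rewrite ler_wpM2r// lerDl.
by rewrite -ltr_pdivlMl// mulrC.
Qed.

Lemma clip_continuous : continuous (@clip R).
Proof.
by apply: (lipschitz_continuous ler01) => x y; rewrite mul1r clip_lip.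
Qed.

Lemma affine_continuous (S : topologicalType) (f : S -> R) (b s : R) :
  continuous f -> continuous (fun x => b + s * f x).
Proof.
move=> cf x; apply: (@cvgD R R^o); first exact: cvg_cst.
by apply: cvgM; [exact: cvg_cst|exact: cf].
Qed.

Lemma prod_continuous (S : topologicalType) (I : Type) (r : seq I)
    (F : I -> S -> R) :
  (forall i, continuous (F i)) -> continuous (fun x => \prod_(i <- r) F i x).
Proof.
move=> cF; elim: r => [|i r IH] x.
  by under eq_fun do rewrite big_nil; exact: cvg_cst.
under eq_fun do rewrite big_cons.
by apply: cvgM; [exact: cF|exact: IH].
Qed.

Lemma prod01 (I : Type) (r : seq I) (F : I -> R) :
  (forall i, 0 <= F i <= 1) -> 0 <= \prod_(i <- r) F i <= 1.
Proof.
move=> F01; elim: r => [|i r /andP[p0 p1]]; first by rewrite big_nil ler01 lexx.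
have /andP[f0 f1] := F01 i.
by rewrite big_cons mulr_ge0//= mulr_ile1.
Qed.

Section Approximation.
Variables (d : measure_display) (Om : measurableType d) (P : probability Om R).
Variable X : Om -> realseq R.
Hypothesis mX : forall i, measurable_fun setT (fun w => X w i).

Lemma cell_measurable N (j : tent_index N) :
  measurable_fun setT (fun w => cell j (X w)).
Proof.
apply: measurable_prod => i _; apply: (@measurableT_comp _ _ _ _ _ _
  (tent N (j i)) _ (fun w => X w i)) => //.
apply: continuous_measurable_fun.
by apply: (@lipschitz_continuous (2 * N%:R)) (tent_lip _ _); rewrite mulr_ge0.
Qed.

Lemma tent_approx_measurable (f : realseq R -> R) N :
  measurable_fun setT (fun w => tent_approx f N (X w)).
Proof.
by apply: measurable_sum => j; apply: measurable_funM => //; exact: cell_measurable.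
Qed.

(** Only the coordinates of [X] are known to be measurable; [f] of [X] is a pointwise limit of
    finite combinations of products of functions of single coordinates. *)
Lemma realseq_continuous_measurable (f : realseq R -> R) :
  continuous f -> (forall x, 0 <= f x) -> measurable_fun setT (fun w => f (X w)).
Proof.
move=> cf f0; apply: (measurable_fun_cvg (tent_approx_measurable f)) => w _.
exact: cvg_tent_approx.
Qed.

Lemma cell_integral_cvg (f : realseq R -> R) (C : R) : continuous f ->
  (forall x, 0 <= f x <= C) ->
  \int[P]_w tent_approx f N (X w) @[N --> \oo] --> \int[P]_w f (X w).
Proof.
move=> cf f0C; have f0 x : 0 <= f x by case/andP: (f0C x).
have mf : measurable_fun setT (fun w => f (X w)).
  exact: realseq_continuous_measurable.
have iP : P.-integrable setT (cst C%:E).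
  apply: (@bounded_integrable _ _ _ P (cst C) `|C|) => //.
have [|||||/integrableP[_ fi] _ lim] := @dominated_convergence _ _ _ P setT measurableT
  (fun N w => (tent_approx f N (X w))%:E) (fun w => (f (X w))%:E) (cst C%:E).
- by move=> N; apply/measurable_EFinP; exact: tent_approx_measurable.
- exact/measurable_EFinP.
- apply: aeW => w _; apply/fine_cvgP; split; first exact: nearW.
  exact: cvg_tent_approx.
- exact: iP.
- apply: aeW => w N _ /=; rewrite lee_fin ger0_norm ?tent_approx_ge0//.
  by rewrite (le_trans (tent_approx_le f0 _ _))//; case/andP: (f0C (X w)).
apply: fine_cvg; rewrite fineK//.
apply: integral_bounded_fin mf _ => w; exact: f0C.
Qed.

End Approximation.

Theorem cvg_in_distribution_realseq
    (dn : nat -> measure_display) (On : forall n, measurableType (dn n))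
    (Pn : forall n, probability (On n) R) (Xn : forall n, On n -> realseq R)
    (d : measure_display) (Om : measurableType d) (P : probability Om R)
    (X : Om -> realseq R) :
  (forall n i, measurable_fun setT (fun w => Xn n w i)) ->
  (forall i, measurable_fun setT (fun w => X w i)) ->
  (forall (k : nat) (phi : nat -> R -> R) (L : R), 0 <= L ->
    (forall i x, 0 <= phi i x <= 1) ->
    (forall i x y, `|phi i x - phi i y| <= L * `|x - y|) ->
    \int[Pn n]_w (\prod_(i < k) phi i (Xn n w i)) @[n --> \oo] -->
    \int[P]_w (\prod_(i < k) phi i (X w i))) ->
  cvg_in_distribution Pn Xn P X.
Proof.
move=> mXn mX cvg_prod.
have cvg_cell N (j : tent_index N) :
    \int[Pn n]_w cell j (Xn n w) @[n --> \oo] --> \int[P]_w cell j (X w).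
  (* Indices from [N] on do not occur in the product; they receive a tent so that the bounds hold
     for every [i]. *)
  pose phi i := if insub i is Some i' then tent N (j i') else tent N 0 : R -> R.
  have phiE (i : 'I_N) : phi i = tent N (j i) by rewrite /phi valK.
  have := @cvg_prod N phi (2 * N%:R); rewrite /cell.
  under eq_fun do under eq_Rintegral do under eq_bigr do rewrite phiE.
  under [X in _ --> X]eq_Rintegral do under eq_bigr do rewrite phiE.
  apply; first by rewrite mulr_ge0.
  - by move=> i x; rewrite /phi; case: insub => *; exact: tent01.
  - by move=> i x y; rewrite /phi; case: insub => *; exact: tent_lip.
have Rint_approx (d' : measure_display) (Om' : measurableType d')
    (P' : probability Om' R) (X' : Om' -> realseq R) f N :
    (forall i, measurable_fun setT (fun w => X' w i)) ->
    \int[P']_w tent_approx f N (X' w) =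
    \sum_(j : tent_index N) cell_inf f j * \int[P']_w cell j (X' w).
  move=> mX'; have cb (j : tent_index N) w : `|cell j (X' w)| <= 1.
    rewrite ger0_norm ?cell_ge0//.
    by have /andP[] := prod01 (index_enum 'I_N) (fun i : 'I_N => tent01 N (j i) (X' w i)).
  rewrite /tent_approx Rintegral_sum; last 2 first.
  - by move=> j; apply: measurable_funM => //; exact: cell_measurable.
  - move=> j; exists `|cell_inf f j| => w.
    by rewrite normrM ler_piMr.
  apply: eq_bigr => j _; rewrite RintegralZl//.
  by apply: bounded_integrable (cb j); exact: cell_measurable.
have cvg_approx f N : \int[Pn n]_w tent_approx f N (Xn n w) @[n --> \oo] -->
    \int[P]_w tent_approx f N (X w).
  rewrite Rint_approx//; under eq_fun do rewrite Rint_approx//.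
  apply: cvg_big => [|j _]; [exact: add_continuous|apply: cvgM].
    exact: cvg_cst.
  exact: cvg_cell.
(* [N] is fixed first, from the limit law alone, at a cost of [e / 2]; large [n] costs another
   [e / 2], and the approximant is below [f] under every law. *)
have lower (f : realseq R -> R) (C e : R) :
    continuous f -> (forall x, 0 <= f x <= C) -> 0 < e ->
    \forall n \near \oo, \int[P]_w f (X w) - e < \int[Pn n]_w f (Xn n w).
  move=> cf f0C e0; have f0 x : 0 <= f x by case/andP: (f0C x).
  have e2 : 0 < e / 2 by rewrite divr_gt0.
  have /cvgrPdist_lt/(_ _ e2)[N _ /(_ N (leqnn N)) fN] :=
    cell_integral_cvg (P := P) mX cf f0C.
  have /cvgrPdist_lt/(_ _ e2) := cvg_approx f N; apply: filterS => n fn.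
  have le : \int[Pn n]_w tent_approx f N (Xn n w) <= \int[Pn n]_w f (Xn n w).
    apply: le_Rintegral => //.
    - apply: (@bounded_integrable _ _ _ _ _ C); first exact: tent_approx_measurable.
      move=> w; rewrite ger0_norm ?tent_approx_ge0//.
      by rewrite (le_trans (tent_approx_le f0 _ _))//; case/andP: (f0C (Xn n w)).
    - apply: (@bounded_integrable _ _ _ _ _ C).
        exact: realseq_continuous_measurable.
      by move=> w; rewrite ger0_norm//; case/andP: (f0C (Xn n w)).
    - by move=> w _; exact: tent_approx_le.
  by move: fN fn; rewrite !ltr_norml => /andP[? ?] /andP[? ?]; lra.
move=> f cf [B fB]; apply/cvgrPdist_lt => e e0.
have fBl x : - B <= f x by have := fB x; rewrite ler_norml => /andP[].
have fBr x : f x <= B by have := fB x; rewrite ler_norml => /andP[].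
(* The bound [lower] concerns nonnegative functions. It is used for [s = 1] and [s = -1], which
   gives the two sides of the limit. *)
have shift (s : R) (d' : measure_display) (Om' : measurableType d')
    (P' : probability Om' R) (X' : Om' -> realseq R) :
    (forall i, measurable_fun setT (fun w => X' w i)) ->
    \int[P']_w (B + s * f (X' w)) = B + s * \int[P']_w f (X' w).
  move=> mX'.
  have mf : measurable_fun setT (fun w => f (X' w)).
    rewrite (_ : (fun w => _) = (fun w => (B + 1 * f (X' w)) - B)); last first.
      by apply/funext => w; lra.
    apply: measurable_funB => //.
    apply: (realseq_continuous_measurable mX' (f := fun x => B + 1 * f x)).
      exact: affine_continuous.
    by move=> x; have := fBl x; lra.
  have fi := bounded_integrable P' mf (fun w => fB (X' w)).
  rewrite RintegralD//.
  - have P1 : P' setT = 1%E by exact: probability_setT.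
    rewrite Rintegral_cst// (_ : fine _ = 1); last exact: (congr1 fine P1).
    by rewrite mulr1 RintegralZl.
  - by apply: (@bounded_integrable _ _ _ _ (cst B) `|B|).
  - apply: (@bounded_integrable _ _ _ _ (fun w => s * f (X' w)) (`|s| * B)).
      exact: measurable_funM.
    by move=> w; rewrite normrM ler_wpM2l.
have up : \forall n \near \oo, B + 1 * \int[P]_w f (X w) - e <
    B + 1 * \int[Pn n]_w f (Xn n w).
  have := @lower (fun x => B + 1 * f x) (B + B) e _ _ e0.
  rewrite shift//; under eq_near do rewrite shift//; apply.
    exact: affine_continuous.
  by move=> x; have := fBl x; have := fBr x => ? ?; apply/andP; split; lra.
have dn' : \forall n \near \oo, B + (-1) * \int[P]_w f (X w) - e <
    B + (-1) * \int[Pn n]_w f (Xn n w).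
  have := @lower (fun x => B + (-1) * f x) (B + B) e _ _ e0.
  rewrite shift//; under eq_near do rewrite shift//; apply.
    exact: affine_continuous.
  by move=> x; have := fBl x; have := fBr x => ? ?; apply/andP; split; lra.
near=> n; rewrite ltr_norml; apply/andP; split.
  have : B + (-1) * \int[P]_w f (X w) - e < B + (-1) * \int[Pn n]_w f (Xn n w).
    by near: n.
  by lra.
have : B + 1 * \int[P]_w f (X w) - e < B + 1 * \int[Pn n]_w f (Xn n w).
  by near: n.
by lra.
Unshelve. all: by end_near. Qed.

End ProductFunctionals.

(** * Graph components as metric measure spaces *)

Section CountingMeasure.
Variable R : realType.

Lemma counting_uniq (T : choiceType) (s : seq T) (A : set T) :
  uniq s -> (forall x, x \in s) ->
  counting A = (\sum_(x <- s) \1_A x)%:E :> \bar R.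
Proof.
move=> us sT.
have finA : finite_set A.
  apply: (@sub_finite_set _ _ [set` s]); last exact: finite_seq.
  by move=> x _; exact: sT.
rewrite /counting asboolT//; congr EFin.
have -> : size (finmap.enum_fset (fset_set A)) = count (mem A) s.
  rewrite -size_filter; apply/perm_size/uniq_perm.
  - exact: finmap.fset_uniq.
  - exact: filter_uniq.
  - by move=> x; rewrite in_fset_set// mem_filter sT andbT.
rewrite -sum1_count natr_sum big_mkcond/=; apply: eq_bigr => x _.
by rewrite indicE; case: (x \in A).
Qed.

Lemma mnormalizeE (d : measure_display) (T : measurableType d)
    (m : {measure set T -> \bar R}) (P : probability T R) (r : R) (A : set T) :
  m setT = r%:E -> 0 < r -> mnormalize m P A = (m A * r^-1%:E)%E.
Proof. by move=> mT r0; rewrite /mnormalize mT eqe gt_eqF. Qed.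

End CountingMeasure.

Section ComponentSpaces.
Variables (R : realType) (c : {posnum R}) (n : nat) (e : rel 'I_n).
Variable esym : symmetric e.

Section Nonempty.
Variables (C : {set 'I_n}) (x0 : 'I_n) (Cx0 : x0 \in C).
Local Notation T := (comp_space c esym Cx0).
Local Notation X := (nonempty_comp_mm c esym Cx0).

Definition comp_point (x : {x : 'I_n | x \in C}) : T :=
  exist _ (nat_of_ord (val x)) (comp_label (valP x)).

Lemma comp_pointK (x : {x : 'I_n | x \in C}) :
  comp_vertex (comp_point x) = val x.
Proof. by apply: val_inj; rewrite /= comp_vertexE. Qed.

Lemma comp_vertexK (u : T) :
  comp_point (exist (fun x => x \in C) _ (comp_vertex_in u)) = u.
Proof. by apply: val_inj; rewrite /= comp_vertexE. Qed.

Lemma comp_distE (u v : T) :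
  mdist u v = c%:num * (gdist e (comp_vertex u) (comp_vertex v))%:R.
Proof. by []. Qed.

Lemma bigmax_attained (F : 'I_n -> nat) :
  exists2 x, x \in C & (\max_(y in C) F y)%N = F x.
Proof.
have [|x xC ->] := eq_bigmax_cond F (A := mem C); last by exists x.
by apply/card_gt0P; exists x0.
Qed.

Lemma nonempty_comp_rad (u : X) :
  mm_rad u = c%:num * (graph_rad e C (comp_vertex (u : T)))%:R.
Proof.
apply/eqP; rewrite eq_le; apply/andP; split.
  apply: rad_le => v; rewrite comp_distE ler_pM2l// ler_nat.
  exact: (leq_bigmax_cond _ (comp_vertex_in v)).
have [y yC yE] := bigmax_attained (gdist e (comp_vertex (u : T))).
have := mdist_le_rad u (comp_point (exist (fun x => x \in C) y yC)).
by rewrite comp_distE comp_pointK /= -yE.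
Qed.

Lemma nonempty_comp_diam : mm_diam X = c%:num * (graph_diam e C)%:R.
Proof.
apply/eqP; rewrite eq_le; apply/andP; split.
  apply: diam_le => u v; rewrite comp_distE ler_pM2l// ler_nat.
  apply: leq_trans (leq_bigmax_cond _ (comp_vertex_in u)).
  exact: (leq_bigmax_cond _ (comp_vertex_in v)).
have [x xC xE] := bigmax_attained (fun x => \max_(y in C) gdist e x y)%N.
have [y yC yE] := bigmax_attained (gdist e x).
have := @mdist_le_diam _ X (comp_point (exist (fun x => x \in C) x xC))
  (comp_point (exist (fun x => x \in C) y yC)).
by rewrite comp_distE !comp_pointK /= -yE -xE.
Qed.

Let pts : seq T := [seq comp_point x | x : {x : 'I_n | x \in C}].

Let pts_uniq : uniq pts.
Proof.
rewrite map_inj_uniq ?enum_uniq// => x y xy.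
by apply: val_inj; rewrite -!comp_pointK xy.
Qed.

Let mem_pts (u : T) : u \in pts.
Proof.
apply/mapP; exists (exist (fun x => x \in C) _ (comp_vertex_in u)); rewrite ?mem_enum//.
by rewrite comp_vertexK.
Qed.

Let size_pts : size pts = #|C|.
Proof. by rewrite size_map -cardE card_sig; apply: eq_card. Qed.

Lemma nonempty_comp_mu (A : set (borel T)) :
  mm_mu X A = ((\sum_(u <- pts) \1_A u) / #|C|%:R)%:E.
Proof.
have C0 : (0 < #|C|)%N by apply/card_gt0P; exists x0.
have cT : counting [set: T] = #|C|%:R%:E :> \bar R.
  rewrite (counting_uniq _ _ pts_uniq mem_pts); congr EFin.
  rewrite (eq_bigr (fun=> 1)) => [|u _]; last by rewrite indicT.
  by rewrite big_const_seq count_predT size_pts iter_addr_0.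
have CR : 0 < #|C|%:R :> R by rewrite ltr0n.
have E := @mnormalizeE R _ (borel T) counting (dirac (point : borel T)) _ A cT CR.
apply: (etrans E).
apply: etrans (congr1 (fun z => z * _)%E (counting_uniq R A pts_uniq mem_pts)) _.
by rewrite -EFinM.
Qed.

(** On measurable sets the measure agrees with a scaled finite sum of Dirac masses, whose integral
    is computed term by term. *)
Lemma nonempty_comp_integral (f : T -> R) :
  measurable_fun (setT : set (borel T)) f -> (forall u, 0 <= f u) ->
  \int[mm_mu X]_u f u = (\sum_(u <- pts) f u) / #|C|%:R.
Proof.
move=> mf f0.
have C1 : 0 <= #|C|%:R^-1 :> R by rewrite invr_ge0.
pose D (i : nat) : {measure set (borel T) -> \bar R} :=
  dirac (nth point pts i : borel T).
pose m2 := mscale (NngNum C1) (msum D (size pts)).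
have mE (A : set (borel T)) : measurable A -> A `<=` setT -> mm_mu X A = m2 A.
  move=> mA _; rewrite nonempty_comp_mu /m2 /mscale/= /msum.
  rewrite (big_nth point) big_mkord mulrC EFinM -sumEFin.
  by congr (_ * _)%E; apply: eq_bigr => i _; rewrite /D/= diracE indicE.
rewrite /Rintegral (eq_measure_integral m2 mE) ge0_integral_mscale//; last 2 first.
- exact/measurable_EFinP.
- by move=> u _; rewrite lee_fin.
rewrite ge0_integral_measure_sum//; last 2 first.
- by move=> u _; rewrite lee_fin.
- exact/measurable_EFinP.
rewrite (eq_bigr (fun i : 'I_(size pts) => (f (nth point pts i))%:E)); last first.
  move=> i _; rewrite integral_dirac//; last exact/measurable_EFinP.
  by rewrite diracT mul1e.
by rewrite sumEFin -EFinM/= mulrC [in RHS](big_nth point) big_mkord.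
Qed.

Lemma nonempty_radial_mean (phi : R -> R) (L : R) : 0 <= L ->
  (forall r, 0 <= phi r <= 1) ->
  (forall r s, `|phi r - phi s| <= L * `|r - s|) ->
  radial_mean phi X =
  (\sum_(x in C) phi (c%:num * (graph_rad e C x)%:R)) / #|C|%:R.
Proof.
move=> L0 phi01 phiL; rewrite /radial_mean nonempty_comp_integral; last 2 first.
- exact: (radial_measurable (X := X) L0 phiL).
- by move=> u; case/andP: (phi01 (mm_rad (u : X))).
congr (_ / _); rewrite /pts big_map big_enum/= [RHS]big_sub.
apply: eq_bigr => x _; rewrite -[in RHS]comp_pointK.
by rewrite (nonempty_comp_rad (comp_point x)).
Qed.

Lemma nonempty_mass : mm_mass X = 1.
Proof.
have C0 : (0 < #|C|)%N by apply/card_gt0P; exists x0.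
rewrite /mm_mass nonempty_comp_mu/= (eq_bigr (fun=> 1)); last first.
  by move=> u _; rewrite indicT.
rewrite big_const_seq count_predT size_pts iter_addr_0 divff//.
by rewrite pnatr_eq0 -lt0n.
Qed.

End Nonempty.
End ComponentSpaces.

Section ComponentFunctionals.
Variables (R : realType) (c : {posnum R}) (n : nat) (e : rel 'I_n).
Variable esym : symmetric e.

Lemma comp_mm_mass (C : {set 'I_n}) : mm_mass (comp_mm c esym C) = 1.
Proof.
rewrite /comp_mm; case: set_0Vmem => [_|[x0 Cx0]]; last exact: nonempty_mass.
by rewrite /point_mm nonempty_mass.
Qed.

Lemma graph_rad_I1 (e1 : rel 'I_1) (C1 : {set 'I_1}) x : graph_rad e1 C1 x = 0%N.
Proof. by apply: big1 => y _; rewrite (ord1 x) (ord1 y) gdistxx. Qed.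

Lemma graph_diam_I1 (e1 : rel 'I_1) (C1 : {set 'I_1}) : graph_diam e1 C1 = 0%N.
Proof. by apply: big1 => x _; exact: graph_rad_I1. Qed.

Lemma comp_mm_diam (C : {set 'I_n}) :
  mm_diam (comp_mm c esym C) = c%:num * (graph_diam e C)%:R.
Proof.
rewrite /comp_mm; case: set_0Vmem => [C0|[x0 Cx0]]; last exact: nonempty_comp_diam.
rewrite /point_mm nonempty_comp_diam graph_diam_I1 C0.
by rewrite /graph_diam big_set0.
Qed.

(** The conventions for a missing component agree: the vertex [None] has radius 0 and weight 1, and
    the one-point space has radius 0 and mass 1. *)
Lemma comp_mm_radial_mean (C : {set 'I_n}) (phi : R -> R) (L : R) : 0 <= L ->
  (forall r, 0 <= phi r <= 1) ->
  (forall r s, `|phi r - phi s| <= L * `|r - s|) ->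
  radial_mean phi (comp_mm c esym C) =
  \sum_(v : option 'I_n)
    uniform_vertex R C v * phi (c%:num * (ograph_rad e C v)%:R).
Proof.
move=> L0 phi01 phiL.
have -> : \sum_(v : option 'I_n)
    uniform_vertex R C v * phi (c%:num * (ograph_rad e C v)%:R) =
  (C == finset.set0)%:R * phi 0 +
  \sum_(x in C) phi (c%:num * (graph_rad e C x)%:R) / #|C|%:R.
  rewrite (bigD1 None)//= mulr0; congr (_ + _).
  rewrite (reindex_omap Some id)/=; last by case.
  rewrite [RHS]big_mkcond/=; apply: eq_big => [x|x _]; first by rewrite eqxx.
  by case: (x \in C); rewrite /= ?mul0r// mul1r mulrC.
rewrite /comp_mm; case: set_0Vmem => [->|[x0 Cx0]].
  rewrite eqxx mul1r big_set0 addr0 /point_mm (nonempty_radial_mean _ _ _ L0)//.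
  rewrite (eq_bigr (fun=> phi 0)) => [|x _]; last by rewrite graph_rad_I1 mulr0.
  by rewrite sumr_const cardsT card_ord divr1.
rewrite (nonempty_radial_mean _ _ _ L0)//.
have -> : (C == finset.set0) = false by apply/negbTE/set0Pn; exists x0.
by rewrite mul0r add0r mulr_suml.
Qed.

End ComponentFunctionals.

(** * The percolated graph as a finite random variable *)

Section FiniteRandomVariables.
Variables (R : realType) (d : measure_display) (Om : measurableType d).
Variables (P : probability Om R) (I : finType) (Z : Om -> I).
Hypothesis mZ : forall i, measurable (Z @^-1` [set i]).

Lemma finite_sum_indic (h : I -> R) w :
  h (Z w) = \sum_i h i * \1_(Z @^-1` [set i]) w.
Proof.
rewrite (bigD1 (Z w))//= big1 => [|i /negP iZ].
  by rewrite addr0 indicE mem_set ?mulr1.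
rewrite indicE memNset ?mulr0//= => Zi; apply: iZ.
by rewrite Zi.
Qed.

Lemma finite_measurable (h : I -> R) : measurable_fun setT (fun w => h (Z w)).
Proof.
under eq_fun do rewrite finite_sum_indic.
by apply: measurable_sum => i; exact: measurable_funM.
Qed.

Lemma Rintegral_finite (h : I -> R) :
  \int[P]_w h (Z w) = \sum_i h i * fine (P (Z @^-1` [set i])).
Proof.
under eq_Rintegral do rewrite finite_sum_indic.
have ind_bound (A : set Om) w : `|\1_A w| <= 1 :> R.
  by rewrite indicE; case: (_ \in _); rewrite ?normr1 ?normr0.
rewrite Rintegral_sum; last 2 first.
- by move=> i; exact: measurable_funM.
- by move=> i; exists `|h i| => w; rewrite normrM ler_piMr.
apply: eq_bigr => i _; rewrite RintegralZl//; last first.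
  by apply: (bounded_integrable _ _ (ind_bound _)); exact: measurable_indic.
by rewrite /Rintegral integral_indic// setIT.
Qed.

End FiniteRandomVariables.

Section Percolation.
Variables (R : realType) (eta : R) (n : nat) (G : graph_model n) (p : R).
Variable X : percolation G p.

(** There are at most [n] components, so the first [n] entries determine the whole sequence. With
    this encoding the state takes finitely many values and expectations become finite sums. *)
Definition comp_table : finType := {ffun 'I_n -> {set 'I_n}}.

Definition table_comp (c : comp_table) : nat -> {set 'I_n} :=
  fun i => if insub i is Some i' then c i' else finset.set0.

Lemma table_compK (w : pc_Om X) :
  table_comp [ffun i : 'I_n => pc_comp w i] = pc_comp w.
Proof.
apply/funext => i; rewrite /table_comp; case: insubP => [i' _ <-|].
  by rewrite ffunE.
rewrite -leqNgt => ni; have [cs [pcs _ ->]] := pc_comp_ranked w.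
rewrite nth_default// (leq_trans _ ni)// (perm_size pcs) -cardE.
by rewrite (leq_trans (leq_imset_card _ _))// card_ord.
Qed.

Definition pc_state (w : pc_Om X) : {set {set gm_end G}} * comp_table :=
  (pc_kept w, [ffun i : 'I_n => pc_comp w i]).

Definition vtx_table (k : nat) (w : pc_Om X) : {ffun 'I_k -> option 'I_n} :=
  [ffun i : 'I_k => pc_vtx w i].

Lemma pc_state_preimage s : pc_state @^-1` [set s] =
  [set w | pc_kept w = s.1 /\ pc_comp w = table_comp s.2].
Proof.
apply/seteqP; split => w /=; first by move=> <-; rewrite /= table_compK.
move=> [kE cE]; rewrite /pc_state kE; case: s kE cE => S c /= _ cE.
congr pair; apply/ffunP => i; rewrite ffunE cE /table_comp insubT// => iln.
by congr (c _); apply: val_inj.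
Qed.

Lemma vtx_table_preimage k (v : {ffun 'I_k -> option 'I_n}) :
  vtx_table k @^-1` [set v] = [set w | forall i, (i < k)%N ->
    pc_vtx w i = (if insub i is Some i' then v i' else None)].
Proof.
apply/seteqP; split => w /=.
  by move=> <- i ik; rewrite insubT ffunE.
move=> vE; apply/ffunP => i; rewrite ffunE vE// insubT// => ik.
by congr (v _); apply: val_inj.
Qed.

Lemma pc_state_law s k (v : {ffun 'I_k -> option 'I_n}) :
  [/\ measurable (pc_state @^-1` [set s]),
      measurable ((fun w => (pc_state w, vtx_table k w)) @^-1` [set (s, v)]) &
      fine (pc_P X ((fun w => (pc_state w, vtx_table k w)) @^-1` [set (s, v)])) =
      fine (pc_P X (pc_state @^-1` [set s])) *
        \prod_(i < k) uniform_vertex R (table_comp s.2 i) (v i)].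
Proof.
have [mA mAB PAB] := @pc_vtx_law _ _ _ _ X s.1 (table_comp s.2) k
  (fun i => if insub i is Some i' then v i' else None).
have -> : (fun w => (pc_state w, vtx_table k w)) @^-1` [set (s, v)] =
    pc_state @^-1` [set s] `&` vtx_table k @^-1` [set v].
  by apply/seteqP; split => w /=; [case=> -> ->|case=> <- <-].
rewrite pc_state_preimage vtx_table_preimage; split => //.
rewrite PAB fineM ?fin_num_measure//=; congr (_ * _).
by apply: eq_bigr => i _; rewrite valK.
Qed.

(** The two scalings can differ only at [n = 0], where there is no vertex and the radius is 0. *)
Lemma scaled_radsE (w : pc_Om X) i : scaled_rads eta w i =
  (graph_scale eta n)%:num *
    (ograph_rad (adj (pc_kept w)) (pc_comp w i) (pc_vtx w i))%:R.
Proof.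
rewrite /scaled_rads; have [n0|n0] := posnP n; last by rewrite /= prednK.
have -> : ograph_rad (adj (pc_kept w)) (pc_comp w i) (pc_vtx w i) = 0%N.
  by case: (pc_vtx w i) => [[m mn]|//]; exfalso; rewrite n0 in mn.
by rewrite !mulr0.
Qed.

Lemma scaled_diamsE (w : pc_Om X) :
  scaled_diams eta w = (fun i => mm_diam (scaled_comps eta w i)).
Proof.
apply/funext => i; rewrite /scaled_diams comp_mm_diam.
have [n0|n0] := posnP n; last by rewrite /= prednK.
have -> : graph_diam (adj (pc_kept w)) (pc_comp w i) = 0%N.
  by apply: big1 => -[m mn]; exfalso; rewrite n0 in mn.
by rewrite !mulr0.
Qed.

Lemma scaled_rads_measurable i :
  measurable_fun setT (fun w : pc_Om X => scaled_rads eta w i).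
Proof.
have mZ s : measurable ((fun w => (pc_state w, vtx_table i.+1 w)) @^-1` [set s]).
  by case: s => s v; have [] := pc_state_law s v.
have := finite_measurable mZ (fun s => (graph_scale eta n)%:num *
  (ograph_rad (adj s.1.1) (table_comp s.1.2 i) (s.2 ord_max))%:R).
congr measurable_fun; apply/funext => w.
by rewrite scaled_radsE /= table_compK ffunE.
Qed.

(** Given the state, the vertices have a product law. Summing over all vertex tables and exchanging
    sum and product leaves one average per component, which is its radial mean. *)
Lemma Rintegral_scaled_rads k (phi : nat -> R -> R) (L : R) : 0 <= L ->
  (forall i r, 0 <= phi i r <= 1) ->
  (forall i r s, `|phi i r - phi i s| <= L * `|r - s|) ->
  \int[pc_P X]_w (\prod_(i < k) phi i (scaled_rads eta w i)) =
  \int[pc_P X]_w (\prod_(i < k) radial_mean (phi i) (scaled_comps eta w i)).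
Proof.
move=> L0 phi01 phiL.
have mS s : measurable (pc_state @^-1` [set s]).
  by have [] := pc_state_law s [ffun=> None : option 'I_n] (k := 0).
have mZ s : measurable ((fun w => (pc_state w, vtx_table k w)) @^-1` [set s]).
  by case: s => s v; have [] := pc_state_law s v.
pose u (s : {set {set gm_end G}} * comp_table) i v := phi i ((graph_scale eta n)%:num *
  (ograph_rad (adj s.1) (table_comp s.2 i) v)%:R).
pose h (s : _ * {ffun 'I_k -> option 'I_n}) := \prod_(i < k) u s.1 i (s.2 i).
have -> : \int[pc_P X]_w (\prod_(i < k) phi i (scaled_rads eta w i)) =
    \int[pc_P X]_w h (pc_state w, vtx_table k w).
  apply: eq_Rintegral => w _; apply: eq_bigr => i _.
  by rewrite scaled_radsE /u/= table_compK ffunE.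
pose g s := \prod_(i < k) \sum_(v : option 'I_n)
  uniform_vertex R (table_comp s.2 i) v * u s i v.
have -> : \int[pc_P X]_w (\prod_(i < k) radial_mean (phi i) (scaled_comps eta w i)) =
    \int[pc_P X]_w g (pc_state w).
  apply: eq_Rintegral => w _; apply: eq_bigr => i _.
  by rewrite (comp_mm_radial_mean _ _ _ L0)// /u/= table_compK.
rewrite (Rintegral_finite _ mZ) (Rintegral_finite _ mS) /h /g.
rewrite (eq_bigr (fun s : _ * {ffun 'I_k -> option 'I_n} =>
    (\prod_(i < k) u s.1 i (s.2 i)) *
    (fine (pc_P X (pc_state @^-1` [set s.1])) *
     \prod_(i < k) uniform_vertex R (table_comp s.1.2 i) (s.2 i)))); last first.
  by case=> s v _; have [_ _ ->] := pc_state_law s v.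
rewrite -(pair_bigA _ (fun s (v : {ffun 'I_k -> option 'I_n}) =>
    (\prod_(i < k) u s i (v i)) *
    (fine (pc_P X (pc_state @^-1` [set s])) *
     \prod_(i < k) uniform_vertex R (table_comp s.2 i) (v i))))/=.
apply: eq_bigr => s _; rewrite bigA_distr_bigA mulr_suml.
apply: eq_bigr => v _; rewrite big_split/= mulrCA mulrC; congr (_ * _).
exact: mulrC.
Qed.

End Percolation.

(** * Passage to the limit *)

Section Limits.
Variable R : realType.

Lemma radial_mean_le_mass (phi : R -> R) (L : R) (X : mmspace R) : 0 <= L ->
  (forall r, 0 <= phi r <= 1) ->
  (forall r s, `|phi r - phi s| <= L * `|r - s|) ->
  radial_mean phi X <= mm_mass X.
Proof.
move=> L0 phi01 phiL; have mphi := radial_measurable (X := X) L0 phiL.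
rewrite /radial_mean /mm_mass; apply: fine_le.
- by apply: (@integral_bounded_fin _ _ _ (mm_mu X) _ 1 mphi) => x; exact: phi01.
- exact: fin_num_measure.
rewrite -[leRHS]mul1e -integral_cst//; apply: ge0_le_integral => //.
- by move=> x _; rewrite lee_fin; case/andP: (phi01 (mm_rad (x : X))).
- exact/measurable_EFinP.
- by move=> x _; rewrite lee_fin; case/andP: (phi01 (mm_rad (x : X))).
Qed.

Lemma clip_id (t : R) : 0 <= t <= 1 -> clip t = t.
Proof. by move=> /andP[t0 t1]; rewrite /clip max_r// min_r. Qed.

Lemma coordinate_continuous (h : mmspace R -> R) (i : nat) :
  continuous h -> continuous (fun x : mmseq R => h (x i)).
Proof.
move=> ch x; apply: (@continuous_comp _ _ _ (fun x : mmseq R => x i) h).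
  exact: proj_continuous.
exact: ch.
Qed.

Lemma diams_continuous :
  continuous (fun x : mmseq R => (fun i => mm_diam (x i)) : realseq R).
Proof.
move=> x.
pose F := (fun x : mmseq R => (fun i => mm_diam (x i)) : realseq R) @ x.
have FF : Filter F := fmap_filter _ (nbhs_filter x).
suff : {ptws, F --> (fun i => mm_diam (x i))} by [].
apply/pointwise_cvgP => i.
exact: (coordinate_continuous (i := i) (@diam_continuous R)).
Qed.

Section Functionals.
Variables (k : nat) (phi : nat -> R -> R) (L : R).
Hypothesis L0 : 0 <= L.
Hypothesis phi01 : forall i r, 0 <= phi i r <= 1.
Hypothesis phiL : forall i r s, `|phi i r - phi i s| <= L * `|r - s|.

(* The measure of an [mmspace] has arbitrary mass, so radial means are unbounded.
   Clipping changes nothing for spaces of mass 1, hence for the components and,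
   almost surely, for their limits. *)
Definition clipped_means (x : mmseq R) : R :=
  \prod_(i < k) clip (radial_mean (phi i) (x i)).

Lemma clipped_means_continuous : continuous clipped_means.
Proof.
apply: prod_continuous => i x.
apply: (@continuous_comp _ _ _
  (fun x : mmseq R => radial_mean (phi i) (x i)) (@clip R)).
  exact: (coordinate_continuous (i := i) (radial_mean_continuous L0 (phi01 i) (phiL i))).
exact: clip_continuous.
Qed.

Lemma clipped_means_bounded : is_bounded clipped_means.
Proof.
exists 1 => x.
have /andP[c0 c1] := prod01 (index_enum 'I_k)
  (fun i : 'I_k => clip01 (radial_mean (phi i) (x i))).
by rewrite ger0_norm.
Qed.

Lemma clipped_means_mass1 (x : mmseq R) : (forall i, mm_mass (x i) = 1) ->
  clipped_means x = \prod_(i < k) radial_mean (phi i) (x i).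
Proof.
move=> x1; apply: eq_bigr => i _; apply: clip_id.
rewrite radial_mean_ge0//= -(x1 i); exact: radial_mean_le_mass L0 _ _.
Qed.

End Functionals.

(** A bounded continuous test function that vanishes exactly when the mass is 1. *)
Definition mass_defect (i : nat) (x : mmseq R) : R :=
  clip `|mm_mass (x i) - 1|.

Lemma mass_defect_continuous i : continuous (mass_defect i).
Proof.
have c1 : continuous (fun r : R => clip `|r - 1|).
  apply: (lipschitz_continuous ler01) => r s; apply: le_trans (clip_lip _ _) _.
  rewrite mul1r (le_trans (ler_dist_dist _ _))//.
  by rewrite opprB addrA subrK.
move=> x; apply: (@continuous_comp _ _ _ (fun x : mmseq R => mm_mass (x i))
  (fun r : R => clip `|r - 1|)); last exact: c1.
exact: (coordinate_continuous (i := i) (@mass_continuous R)).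
Qed.

Section Convergence.
Variables (eta : R) (p : nat -> R) (G : forall n, graph_model n).
Variable X : forall n, percolation (G n) (p n).
Variables (d : measure_display) (Om : measurableType d) (P : probability Om R).
Variable M : Om -> mmseq R.
Hypothesis rM : random_element M.
Hypothesis cvgM_ : cvg_in_distribution (fun n => pc_P (X n))
  (fun n => @scaled_comps R eta n _ _ (X n)) P M.

Lemma scaled_diams_cvg : cvg_in_distribution (fun n => pc_P (X n))
  (fun n => @scaled_diams R eta n _ _ (X n)) P
  (fun w i => mm_diam (M w i)).
Proof.
move=> f cf [B fB].
have := cvgM_ (f := fun x => f (fun i => mm_diam (x i))).
have -> : (fun n => \int[pc_P (X n)]_w f (scaled_diams eta w)) =
    (fun n => \int[pc_P (X n)]_w f (fun i => mm_diam (scaled_comps eta w i))).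
  by apply/funext => n; apply: eq_Rintegral => w _; rewrite scaled_diamsE.
apply; last by exists B => x; exact: fB.
move=> x; apply: (@continuous_comp _ _ _
  (fun x : mmseq R => (fun i => mm_diam (x i)) : realseq R) f).
  exact: diams_continuous.
exact: cf.
Qed.

(** The mass defect has integral 0 for every [n], hence also in the limit, and a nonnegative
    function of integral 0 vanishes almost everywhere. *)
Lemma limit_mass1 : {ae P, forall w, forall i, mm_mass (M w i) = 1}.
Proof.
apply/ae_foralln => i.
have mg : measurable_fun setT (fun w => mass_defect i (M w)).
  exact: (random_element_measurable rM (@mass_defect_continuous i)).
have g01 x : 0 <= mass_defect i x <= 1 by exact: clip01.
have int0 : \int[P]_w mass_defect i (M w) = 0.
  have := cvgM_ (mass_defect_continuous (i := i)).
  have -> : (fun n => \int[pc_P (X n)]_w mass_defect i (scaled_comps eta w)) =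
      cst 0.
    apply/funext => n; rewrite -[RHS](_ : \int[pc_P (X n)]_w 0 = 0 :> R).
      apply: eq_Rintegral => w _.
      by rewrite /mass_defect comp_mm_mass subrr normr0 clip_id// lexx ler01.
    by rewrite Rintegral_cst// mul0r.
  move=> /(_ _)/(cvg_unique (@Rhausdorff R) (cvg_cst _)) -> //.
  by exists 1 => x; have /andP[? ?] := g01 x; rewrite ger0_norm.
have : (\int[P]_w `|(mass_defect i (M w))%:E| = 0)%E.
  under eq_integral do rewrite gee0_abs ?lee_fin ?(proj1 (andP (g01 _)))//.
  rewrite -(fineK (integral_bounded_fin P mg (fun w => g01 (M w)))).
  by congr EFin.
have mgE : measurable_fun setT (fun w => (mass_defect i (M w))%:E).
  exact/measurable_EFinP.
move=> /(ae_eq_integral_abs _ measurableT mgE); apply: filterS => w /(_ I)[g0].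
apply/eqP; rewrite -subr_eq0 -normr_eq0 eq_le normr_ge0 andbT.
rewrite leNgt; apply/negP => m0.
have : 0 < mass_defect i (M w).
  by rewrite /mass_defect /clip lt_min ltr01 lt_max m0 orbT.
by rewrite g0 ltxx.
Qed.

Variable V : forall (w : Om) (i : nat), (M w i : mmspace R).
Hypothesis sV : sampled_points P V.

Lemma limit_rad_measurable i : measurable_fun setT (fun w => mm_rad (V w i)).
Proof.
exact: (random_element_measurable (sV.1 i) (@marked_rad_continuous R)).
Qed.

(** This is the sampling identity with [g] equal to 1; functions of the marked radius qualify since
    they are continuous for the marked distance, hence Borel. *)
Lemma Rintegral_limit_rads k (phi : nat -> R -> R) (L : R) : 0 <= L ->
  (forall i r, 0 <= phi i r <= 1) ->
  (forall i r s, `|phi i r - phi i s| <= L * `|r - s|) ->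
  \int[P]_w (\prod_(i < k) phi i (mm_rad (V w i))) =
  \int[P]_w (\prod_(i < k) radial_mean (phi i) (M w i)).
Proof.
move=> L0 phi01 phiL.
have b1 (S : Type) (f : S -> R) : (forall x, 0 <= f x <= 1) -> is_bounded f.
  by move=> f01; exists 1 => x; have /andP[? ?] := f01 x; rewrite ger0_norm.
have : \int[P]_w (1 * \prod_(i < k) phi i (marked_rad (Marked (M w i) (V w i)))) =
    \int[P]_w (1 * \prod_(i < k)
      \int[mm_mu (M w i)]_x phi i (marked_rad (Marked (M w i) x))).
  apply: (sV.2 (fun=> 1) k (fun i Z => phi i (marked_rad Z))).
  - by apply: continuous_borel_fun; exact: cst_continuous.
  - by apply: b1 => x; rewrite ler01 lexx.
  - move=> i; apply: continuous_borel_fun.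
    exact: marked_radial_continuous L0 (phiL i).
  - by move=> i; apply: b1 => Z; exact: phi01.
under eq_Rintegral do rewrite mul1r.
by under [in RHS]eq_Rintegral do rewrite mul1r.
Qed.

Theorem scaled_rads_cvg : cvg_in_distribution (fun n => pc_P (X n))
  (fun n => @scaled_rads R eta n _ _ (X n)) P (fun w i => mm_rad (V w i)).
Proof.
apply: cvg_in_distribution_realseq.
- by move=> n i; exact: scaled_rads_measurable.
- exact: limit_rad_measurable.
move=> k phi L L0 phi01 phiL.
have -> : (fun n => \int[pc_P (X n)]_w (\prod_(i < k) phi i (scaled_rads eta w i))) =
    (fun n => \int[pc_P (X n)]_w clipped_means k phi (scaled_comps eta w)).
  apply/funext => n; rewrite (Rintegral_scaled_rads eta (X n) k L0 phi01 phiL).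
  apply: eq_Rintegral => w _; rewrite (clipped_means_mass1 _ L0 phi01 phiL)//.
  by move=> i; exact: comp_mm_mass.
(* In the limit the masses are 1 only almost surely, so clipped and unclipped products are compared
   almost everywhere, both being measurable. *)
have -> : \int[P]_w (\prod_(i < k) phi i (mm_rad (V w i))) =
    \int[P]_w clipped_means k phi (M w).
  rewrite (Rintegral_limit_rads k L0 phi01 phiL); congr fine.
  apply: ae_eq_integral => //.
  - apply/measurable_EFinP; apply: measurable_prod => i _.
    exact: (random_element_measurable rM (coordinate_continuous (i := i)
      (radial_mean_continuous L0 (phi01 i) (phiL i)))).
  - apply/measurable_EFinP.
    exact: (random_element_measurable rM
      (@clipped_means_continuous k phi L L0 phi01 phiL)).
  - apply: filterS limit_mass1 => w M1 _.
    by rewrite (clipped_means_mass1 _ L0 phi01 phiL).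
apply: cvgM_; first exact: clipped_means_continuous L0 phi01 phiL.
exact: clipped_means_bounded.
Qed.

End Convergence.
End Limits.

Theorem corollary1p5 (R : realType) (tau : R) (d : nat -> nat -> nat)
    (theta : nat -> R) (nu lambda : R) (p : nat -> R)
    (CM : forall n, percolation (configuration_model n (d n)) (p n))
    (UM : forall n, percolation (uniform_model n (d n)) (p n))
    (disp : measure_display) (Om : measurableType disp) (P : probability Om R)
    (M : Om -> mmseq R) (V : forall (w : Om) (i : nat), (M w i : mmspace R)) :
  3 < tau < 4 ->
  degree_sequences d ->
  assumption1i tau d theta ->
  assumption1ii tau d ->
  assumption2 tau d ->
  nu_n R d n @[n --> \oo] --> nu ->
  1 < nu ->
  (forall n, 0 <= p n <= 1) ->
  (fun n => p n - ((nu_n R d n)^-1 + lambda / n%:R `^ eta tau))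
    =o_\oo (fun n => n%:R `^ (- eta tau)) ->
  random_element M ->
  cvg_in_distribution (fun n => pc_P (CM n))
    (fun n => @scaled_comps R (eta tau) n _ _ (CM n)) P M ->
  cvg_in_distribution (fun n => pc_P (UM n))
    (fun n => @scaled_comps R (eta tau) n _ _ (UM n)) P M ->
  sampled_points P V ->
  let Rad : Om -> realseq R := fun w i => mm_rad (V w i) in
  let Diam : Om -> realseq R := fun w i => mm_diam (M w i) in
  [/\ cvg_in_distribution (fun n => pc_P (CM n))
        (fun n => @scaled_rads R (eta tau) n _ _ (CM n)) P Rad,
      cvg_in_distribution (fun n => pc_P (CM n))
        (fun n => @scaled_diams R (eta tau) n _ _ (CM n)) P Diam,
      cvg_in_distribution (fun n => pc_P (UM n))
        (fun n => @scaled_rads R (eta tau) n _ _ (UM n)) P Rad &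
      cvg_in_distribution (fun n => pc_P (UM n))
        (fun n => @scaled_diams R (eta tau) n _ _ (UM n)) P Diam].
Proof.
move=> _ _ _ _ _ _ _ _ _ rM cvgCM cvgUM sV Rad Diam; split.
- exact: scaled_rads_cvg.
- exact: scaled_diams_cvg.
- exact: scaled_rads_cvg.
- exact: scaled_diams_cvg.
Qed.
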